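(* Let $(M,g)$ be a pseudo-Riemannian manifold with Levi-Civita connection $\nabla^g$, and let $f$ be a smooth function on $M$. Then the affine connection $$\nabla^{df}_XY=\nabla^g_XY+df(X)Y+df(Y)X+g(X,Y)\,\mathrm{grad}_g(f)$$ is an equiaffine connection on $M$.
   Context: An affine connection on $M$ is called equiaffine if it admits a parallel volume form on $M$. $\mathrm{grad}_g(f)$ denotes the gradient of $f$ with respect to $g$, i.e. $g(\mathrm{grad}_g(f),X)=df(X)$ for every vector field $X$.
   Formalization: The formal statement additionally assumes that M is orientable; on a non-orientable manifold (e.g. the flat Möbius band with f = 0) there is no volume form, so the claim fails as stated. *)

(* Defs.v *)
From HB Require Import structures.
From mathcomp Require Import all_boot all_order all_algebra.
From mathcomp Require Import all_classical all_reals all_analysis.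
Import Order.TTheory GRing.Theory Num.Theory numFieldNormedType.Exports.

Set Implicit Arguments.
Unset Strict Implicit.
Unset Printing Implicit Defensive.

Local Open Scope classical_set_scope.
Local Open Scope ring_scope.

Definition partials (R : realType) (n : nat) (s : seq 'I_n) (F : 'rV[R]_n -> R)
    : 'rV[R]_n -> R :=
  foldr (fun i (G : 'rV[R]_n -> R) => fun x => 'D_(delta_mx 0 i) G x) F s.

(* C^infinity on the open set U: all iterated partial derivatives exist and are
   continuous at every point of U. *)
Definition smooth_on (R : realType) (n : nat) (U : set 'rV[R]_n)
    (F : 'rV[R]_n -> R) : Prop :=
  forall (s : seq 'I_n) (x : 'rV[R]_n), U x ->
    {for x, continuous (partials s F)} /\
    forall i : 'I_n, derivable (partials s F) x (delta_mx 0 i).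

(* coord and param are total functions, meaningful only on dom and on
   coord @` dom respectively. *)
Record chart (R : realType) (n : nat) (T : topologicalType) := Chart {
  dom : set T;
  coord : T -> 'rV[R]_n;
  param : 'rV[R]_n -> T;
  dom_open : open dom;
  image_open : open (coord @` dom);
  coordK : forall p, dom p -> param (coord p) = p;
  coord_continuous : {within dom, continuous coord};
  param_continuous : {within coord @` dom, continuous param}
}.

Definition transition (R : realType) (n : nat) (T : topologicalType)
    (a b : chart R n T) : 'rV[R]_n -> 'rV[R]_n := coord b \o param a.

Definition smooth_transition (R : realType) (n : nat) (T : topologicalType)
    (a b : chart R n T) : Prop :=
  forall j : 'I_n,
    smooth_on (coord a @` (dom a `&` dom b)) (fun x => transition a b x 0 j).

(* Vectors are rows: v *m jac a b p are the components in the chart b of the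
   tangent vector at p whose components in the chart a are v. *)
Definition jac (R : realType) (n : nat) (T : topologicalType)
    (a b : chart R n T) (p : T) : 'M[R]_n :=
  jacobian (transition a b) (coord a p).

(* chart_at selects, at each point p, a chart of the atlas; it serves to
   represent tangent vectors at p, see vector_field. *)
Record manifold (R : realType) (n : nat) := Manifold {
  carrier :> topologicalType;
  atlas : set (chart R n carrier);
  chart_at : carrier -> chart R n carrier;
  chart_at_atlas : forall p, atlas (chart_at p);
  chart_at_dom : forall p, dom (chart_at p) p;
  atlas_smooth : forall a b, atlas a -> atlas b -> smooth_transition a b;
  manifold_hausdorff : hausdorff_space carrier;
  manifold_second_countable : @second_countable carrier
}.

Arguments chart_at {R n M} p : rename.
Arguments atlas {R n M} : rename.

(* Through an oriented atlas belonging to the smooth structure of M. *)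
Definition orientable (R : realType) (n : nat) (M : manifold R n) : Prop :=
  exists B : set (chart R n M),
    [/\ forall p : M, exists2 b, B b & dom b p,
        forall a b, atlas a -> B b ->
          smooth_transition a b /\ smooth_transition b a &
        forall b c, B b -> B c -> forall p : M, dom b p -> dom c p ->
          0 < \det (jac b c p)].

(* The tangent space at p is R^n, a tangent vector being represented by its
   components in the chart chart_at p; in another chart c these become
   v *m jac (chart_at p) c p. *)
Definition vector_field (R : realType) (n : nat) (M : manifold R n) : Type :=
  M -> 'rV[R]_n.

(* The i-th coordinate vector of the chart a at p, as a tangent vector at p. *)
Definition coord_vector (R : realType) (n : nat) (M : manifold R n)
    (a : chart R n M) (i : 'I_n) : vector_field M :=
  fun p => row i (jac a (chart_at p) p).

Definition smooth_in_chart (R : realType) (n : nat) (M : manifold R n)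
    (a : chart R n M) (f : M -> R) : Prop :=
  smooth_on (coord a @` dom a) (f \o param a).

Definition smooth_fun (R : realType) (n : nat) (M : manifold R n)
    (f : M -> R) : Prop :=
  forall a, atlas a -> smooth_in_chart a f.

Definition smooth_field (R : realType) (n : nat) (M : manifold R n)
    (X : vector_field M) : Prop :=
  forall a, atlas a -> forall j : 'I_n,
    smooth_in_chart a (fun p => (X p *m jac (chart_at p) a p) 0 j).

Definition dfun (R : realType) (n : nat) (M : manifold R n) (f : M -> R)
    (p : M) (v : 'rV[R]_n) : R :=
  'd (f \o param (chart_at p)) (coord (chart_at p) p) v.

(* X f = df(X) *)
Definition deriv_along (R : realType) (n : nat) (M : manifold R n)
    (X : vector_field M) (f : M -> R) : M -> R :=
  fun p => dfun f p (X p).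

Definition bilinear_field (R : realType) (n : nat) (M : manifold R n) : Type :=
  M -> 'rV[R]_n -> 'rV[R]_n -> R.

Definition pseudo_riemannian_metric (R : realType) (n : nat) (M : manifold R n)
    (g : bilinear_field M) : Prop :=
  [/\ forall (p : M) (u : 'rV[R]_n), scalar (g p u),
      forall (p : M) (u v : 'rV[R]_n), g p u v = g p v u,
      forall (p : M) (u : 'rV[R]_n), (forall v, g p u v = 0) -> u = 0 &
      forall a, atlas a -> forall i j : 'I_n,
        smooth_in_chart a
          (fun p => g p (coord_vector a i p) (coord_vector a j p))].

Definition gradient (R : realType) (n : nat) (M : manifold R n)
    (g : bilinear_field M) (f : M -> R) : vector_field M :=
  fun p => get [set u : 'rV[R]_n | forall v, g p u v = dfun f p v].

(* An operator on smooth vector fields; its values on other fields are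
   irrelevant. *)
Definition field_operator (R : realType) (n : nat) (M : manifold R n) : Type :=
  vector_field M -> vector_field M -> vector_field M.

Record affine_connection (R : realType) (n : nat) (M : manifold R n)
    (nabla : field_operator M) : Prop := AffineConnection {
  connection_smooth : forall X Y, smooth_field X -> smooth_field Y ->
    smooth_field (nabla X Y);
  connection_linear_l : forall f X Y Z, smooth_fun f ->
    smooth_field X -> smooth_field Y -> smooth_field Z ->
    forall p, nabla (fun q => f q *: X q + Y q) Z p
            = f p *: nabla X Z p + nabla Y Z p;
  connection_linear_r : forall (c : R) X Y Z,
    smooth_field X -> smooth_field Y -> smooth_field Z ->
    forall p, nabla X (fun q => c *: Y q + Z q) p
            = c *: nabla X Y p + nabla X Z p;
  connection_leibniz : forall f X Y, smooth_fun f ->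
    smooth_field X -> smooth_field Y ->
    forall p, nabla X (fun q => f q *: Y q) p
            = deriv_along X f p *: Y p + f p *: nabla X Y p
}.

Definition is_lie_bracket (R : realType) (n : nat) (M : manifold R n)
    (X Y Z : vector_field M) : Prop :=
  forall f, smooth_fun f -> forall p,
    deriv_along Z f p =
    deriv_along X (deriv_along Y f) p - deriv_along Y (deriv_along X f) p.

Definition torsion_free (R : realType) (n : nat) (M : manifold R n)
    (nabla : field_operator M) : Prop :=
  forall X Y, smooth_field X -> smooth_field Y ->
    is_lie_bracket X Y (fun p => nabla X Y p - nabla Y X p).

Definition metric_compatible (R : realType) (n : nat) (M : manifold R n)
    (g : bilinear_field M) (nabla : field_operator M) : Prop :=
  forall X Y Z, smooth_field X -> smooth_field Y -> smooth_field Z ->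
    forall p, deriv_along X (fun q => g q (Y q) (Z q)) p
            = g p (nabla X Y p) (Z p) + g p (Y p) (nabla X Z p).

Definition levi_civita (R : realType) (n : nat) (M : manifold R n)
    (g : bilinear_field M) (nabla : field_operator M) : Prop :=
  [/\ affine_connection nabla, torsion_free nabla & metric_compatible g nabla].

Definition replace (R : realType) (n : nat) (v : 'I_n -> 'rV[R]_n) (i : 'I_n)
    (u : 'rV[R]_n) : 'I_n -> 'rV[R]_n :=
  fun j => if j == i then u else v j.

Definition alternating_form (R : realType) (n : nat)
    (w : ('I_n -> 'rV[R]_n) -> R) : Prop :=
  (forall v i, scalar (fun u => w (replace v i u))) /\
  (forall v i j, i != j -> v i = v j -> w v = 0).

(* n being the dimension of M, a top-degree form. *)
Definition form_field (R : realType) (n : nat) (M : manifold R n) : Type :=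
  M -> ('I_n -> 'rV[R]_n) -> R.

Definition volume_form (R : realType) (n : nat) (M : manifold R n)
    (w : form_field M) : Prop :=
  [/\ forall p : M, alternating_form (w p),
      forall p : M, exists v, w p v != 0 &
      forall a, atlas a ->
        smooth_in_chart a (fun p => w p (fun i => coord_vector a i p))].

(* X (w (Y_1, .., Y_n)) = \sum_i w (Y_1, .., nabla_X Y_i, .., Y_n),
   that is, nabla_X w = 0. *)
Definition parallel_form (R : realType) (n : nat) (M : manifold R n)
    (nabla : field_operator M) (w : form_field M) : Prop :=
  forall (X : vector_field M) (Y : 'I_n -> vector_field M),
    smooth_field X -> (forall i, smooth_field (Y i)) ->
    forall p, deriv_along X (fun q => w q (fun i => Y i q)) p =
      \sum_(i < n) w p (replace (fun j => Y j p) i (nabla X (Y i) p)).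

Definition equiaffine (R : realType) (n : nat) (M : manifold R n)
    (nabla : field_operator M) : Prop :=
  affine_connection nabla /\
  exists2 w : form_field M, volume_form w & parallel_form nabla w.

Definition nabla_df (R : realType) (n : nat) (M : manifold R n)
    (g : bilinear_field M) (nabla : field_operator M) (f : M -> R)
    : field_operator M :=
  fun X Y p => nabla X Y p + dfun f p (X p) *: Y p + dfun f p (Y p) *: X p
             + g p (X p) (Y p) *: gradient g f p.

(* Main.v *)
From HB Require Import structures.
From mathcomp Require Import all_boot all_order all_algebra.
From mathcomp Require Import all_classical all_reals all_analysis.
From mathcomp Require Import ring perm.
Require Import Defs.
Import Order.TTheory GRing.Theory Num.Theory numFieldNormedType.Exports.

(* The difference tensor Y |-> df(X) Y + df(Y) X + g(X,Y) grad f has trace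
   (n + 2) df(X), so e^((n+2)f) vol_g is parallel for nabla_df as soon as the
   oriented Riemannian volume vol_g is parallel for the Levi-Civita connection.

   For the latter, fix p, the chart at p, and let V, V', N be the matrices whose
   rows are the Y_i(p), the derivatives along X of their components, and the
   nabla_X Y_i at p; let S be the Gram matrix of g and S' its derivative along X.
   Metric compatibility of two families Y and Z reads
     (V_Y' - N_Y) S V_Z^T + V_Y S' V_Z^T + V_Y S (V_Z' - N_Z)^T = 0.
   Since nabla acts on global fields only, take for Z a frame cut off by a bump
   function, with V_Z a nonzero scalar matrix: this gives
   2 tr((V' - N) adj V) = - det V tr(S' S^-1), also when the Y_i are dependent,
   which cancels the logarithmic derivative of sqrt|det S|. *)

Set Implicit Arguments.
Unset Strict Implicit.
Unset Printing Implicit Defensive.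

Local Open Scope classical_set_scope.
Local Open Scope ring_scope.

(** * Continuously differentiable functions *)

(** The adjugate enters because replacing each row of [V] in turn by the corresponding row of [N]
    and adding the determinants gives [\tr (N *m \adj V)]: parallelism becomes one trace identity,
    polynomial in [V]. The trace of [V' - N] for the test frame is unknown as well; pairing the
    frame with itself determines it, and pairing [Y] with the frame then carries the result over to
    [Y]. The second obstacle is that [chart_at], like the chosen oriented charts, may vary with the
    point without any continuity. Smoothness is therefore always established in a fixed chart, while
    the computation at [p] is made in [chart_at p], where tangent vectors are their own
    components. *)

Section Calculus.
Variable R : realType.

Lemma near_eq_continuous (T U : topologicalType) (F G : T -> U) x :
  {near x, F =1 G} -> {for x, continuous F} -> {for x, continuous G}.
Proof.
move=> FG cF; rewrite /prop_for /continuous_at -(nbhs_singleton FG).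
exact: cvg_trans (near_eq_cvg FG) cF.
Qed.

(** Mean value theorem for [s |-> F (s *: e + y) - s * a]: once the linear part is subtracted, the
    derivative is at most [eps] in absolute value. As [t] may have either sign, the segment from 0
    to [t] is treated in two cases. *)
Lemma line_mean_value (V : normedModType R) (F : V -> R) (y e : V) (a eps t : R) :
  (forall s : R, `|s| <= `|t| -> derivable F (s *: e + y) e /\
     `|'D_e F (s *: e + y) - a| <= eps) ->
  `|F (t *: e + y) - F y - t * a| <= `|t| * eps.
Proof.
move=> H.
pose phi (s : R) := F (s *: e + y) - s * a.
have dphi (s : R) : `|s| <= `|t| -> is_derive s 1 phi ('D_e F (s *: e + y) - a).
  move=> /H[dF _].
  have dF1 : is_derive s 1 (fun s : R => F (s *: e + y)) ('D_e F (s *: e + y)).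
    have E : (fun h : R => h^-1 *: (F ((h *: 1 + s) *: e + y) - F (s *: e + y)))
           = (fun h => h^-1 *: (F (h *: e + (s *: e + y)) - F (s *: e + y))).
      by apply/funext => h; rewrite scalerDl addrA [h *: 1]mulr1.
    by split; rewrite /derivable /derive /= E.
  have dl : is_derive s 1 (fun s : R => s * a) a.
    by apply: is_derive_eq; rewrite ?scaler0 ?add0r ?addr0 [LHS]mulr1.
  exact: is_deriveB.
have phiE : F (t *: e + y) - F y - t * a = phi t - phi 0.
  by rewrite /phi scale0r add0r mul0r subr0 addrAC.
rewrite phiE.
have cont a' b' : (forall s, s \in `[a', b'] -> `|s| <= `|t|) ->
    {within `[a', b'], continuous phi}.
  by move=> sub; apply: derivable_within_continuous => z /sub /dphi; case.
have [t0|t0] := leP 0 t.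
  have sub s : s \in `[0, t] -> `|s| <= `|t|.
    by rewrite in_itv /= => /andP[s0 st]; rewrite !ger0_norm.
  have [] := @MVT_segment R phi (fun s => 'D_e F (s *: e + y) - a) 0 t t0.
  - move=> s st; apply/dphi/sub; apply: subset_itv_oo_cc st.
  - exact: cont.
  move=> c /sub /H[_ Hc] ->; rewrite subr0 normrM mulrC.
  exact: ler_wpM2l.
have sub s : s \in `[t, 0] -> `|s| <= `|t|.
  by rewrite in_itv /= => /andP[ts s0]; rewrite !ler0_norm ?lerN2 // ltW.
have [] := @MVT_segment R phi (fun s => 'D_e F (s *: e + y) - a) t 0 (ltW t0).
- move=> s st; apply/dphi/sub; apply: subset_itv_oo_cc st.
- exact: cont.
move=> c /sub /H[_ Hc]; rewrite sub0r distrC => ->; rewrite normrM normrN mulrC.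
exact: ler_wpM2l.
Qed.

Section Euclidean.
Variable n : nat.
Implicit Types (F G : 'rV[R]_n -> R) (x y : 'rV[R]_n) (i : 'I_n).
Notation e i := (delta_mx 0 i : 'rV[R]_n).

Lemma coord_le_norm (y : 'rV[R]_n) i : `|y 0 i| <= `|y|.
Proof.
rewrite [leRHS]/Num.Def.normr /= mx_normrE.
exact: (le_bigmax _ (fun ij : 'I_1 * 'I_n => `|y ij.1 ij.2|) (0, i)).
Qed.

Lemma norm_le_coord (y : 'rV[R]_n) (r : R) : 0 <= r ->
  (forall i, `|y 0 i| <= r) -> `|y| <= r.
Proof.
move=> r0 H; rewrite [leLHS]/Num.Def.normr /= mx_normrE bigmax_le // => -[i j] _ /=.
by rewrite ord1.
Qed.

(** The increment from [x] to [h + x] is split into moves along one coordinate at a time. By the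
    mean value estimate, each move differs from its linear part by at most a small multiple of
    [|h|], because the partial derivatives stay close to their values at [x]. *)
Lemma C1_differentiable F x :
  (\forall y \near x, forall i, derivable F y (e i)) ->
  (forall i, {for x, continuous ('D_(e i) F)}) ->
  differentiable F x.
Proof.
move=> dF cF.
pose L (v : 'rV[R]_n) : R := \sum_i v 0 i * 'D_(e i) F x.
have lin_L : linear L.
  move=> c u v; rewrite /L scaler_sumr -big_split /=; apply: eq_bigr => i _.
  by rewrite !mxE mulrDl -mulrA.
pose LL := GRing.isLinear.Build _ _ _ _ _ lin_L.
pose dL : {linear 'rV[R]_n -> R} := HB.pack L LL.
have cL : continuous dL.
  move=> v; apply: differentiable_continuous.
  have -> : (dL : _ -> _) = \sum_i (fun v : 'rV[R]_n => 'D_(e i) F x *: v 0 i).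
    by apply/funext => u; rewrite fct_sumE /= /L; apply: eq_bigr => i _; rewrite mulrC.
  apply: differentiable_sum => i; apply: differentiableZ.
  exact: differentiable_coord.
suff E : forall eps : R, 0 < eps -> \forall h \near (0 : 'rV[R]_n),
    `|F (h + x) - (F x + L h)| <= eps * `|h|.
  have D : 'd F x = dL :> (_ -> _) by apply: diff_unique => //; apply/eqaddoP.
  by apply/diff_locallyP; rewrite D; split => //; apply/eqaddoP.
move=> eps eps0.
(* There are [n] coordinate moves; dividing by [n.+1] keeps the quotient meaningful when [n = 0]. *)
pose eps' := eps / n.+1%:R.
have eps'0 : 0 < eps' by rewrite divr_gt0.
have : \forall y \near x, forall i, derivable F y (e i) /\
    `|'D_(e i) F y - 'D_(e i) F x| <= eps'.
  near=> y => i; split; first by move: i; near: y.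
  rewrite distrC; move: i; near: y; apply: filter_forall => i.
  by have /cvgrPdist_le := cF i; apply.
case/nbhs_ballP => d /= d0 Hd.
near=> h.
have hd : `|h| < d by near: h; have := @nbhs0_lt _ 'rV[R]_n d d0; exact.
(* The intermediate points of the path: [hk k] keeps the first [k] coordinates of [h]. *)
pose hk k : 'rV[R]_n := \row_j (if (j < k)%N then h 0 j else 0).
have h0 : hk 0%N = 0 by apply/rowP => j; rewrite !mxE.
have hn : hk n = h by apply/rowP => j; rewrite !mxE ltn_ord.
have hS (i : 'I_n) : hk i.+1 = h 0 i *: e i + hk i.
  apply/rowP => j; rewrite !mxE eqxx /= ltnS.
  case: (eqVneq j i) => [->|ji]; first by rewrite leqnn ltnn mulr1 addr0.
  by rewrite mulr0 add0r ltn_neqAle (inj_eq val_inj) ji.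
have step (i : 'I_n) :
    `|F (hk i.+1 + x) - F (hk i + x) - h 0 i * 'D_(e i) F x| <= `|h 0 i| * eps'.
  rewrite hS -(addrA _ (hk i) x); apply: line_mean_value => s sh.
  apply: Hd; rewrite -ball_normE /ball_ /= addrA opprD addrCA subrr addr0 normrN.
  apply: (@le_lt_trans _ _ `|h|); last exact: hd.
  apply: norm_le_coord => // j; rewrite !mxE eqxx /=.
  case: (eqVneq j i) => [->|ji].
    by rewrite ltnn mulr1 addr0 (le_trans sh) ?coord_le_norm.
  by rewrite mulr0 add0r; case: ifP => _; rewrite ?normr0 ?coord_le_norm.
have -> : F (h + x) - (F x + L h) =
   \sum_(i < n) (F (hk i.+1 + x) - F (hk i + x) - h 0 i * 'D_(e i) F x).
  rewrite sumrB -(big_mkord xpredT (fun k => F (hk k.+1 + x) - F (hk k + x))).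
  rewrite telescope_sumr // h0 hn add0r.
  by rewrite opprD addrA.
apply: le_trans (ler_norm_sum _ _ _) _.
apply: (@le_trans _ _ (\sum_(i < n) `|h| * eps')).
  apply: ler_sum => i _; apply: le_trans (step i) _.
  by rewrite ler_wpM2r ?coord_le_norm // ltW.
rewrite sumr_const card_ord -[_ *+ _]mulr_natr -mulrA mulrC ler_wpM2r //.
rewrite /eps' -mulrA ler_piMr // ?(ltW eps0) // mulrC ler_pdivrMr ?ltr0n // mul1r.
by rewrite ler_nat.
Unshelve. all: by end_near. Qed.

End Euclidean.
End Calculus.

(** * Smooth functions on open sets *)

Section SmoothFunctions.
Variable R : realType.

(** Both difference quotients are the same function of [h]. This reduces the chain rule with a
    one-variable outer function to the real line. *)
Lemma is_derive_line (V W : normedModType R) (F : V -> W) x v d :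
  is_derive (0 : R) 1 (fun h : R => F (h *: v + x)) d <-> is_derive x v F d.
Proof.
have E : (fun h : R => h^-1 *: (F ((h *: 1 + 0) *: v + x) - F (0 *: v + x)))
       = (fun h : R => h^-1 *: (F (h *: v + x) - F x)).
  by apply/funext => h; rewrite scale0r add0r addr0 [h *: 1]mulr1.
by split => -[H1 H2]; split; move: H1 H2; rewrite /derivable /derive /= E.
Qed.

Lemma is_derive_comp (V : normedModType R) (F : V -> R) (h : R -> R) x v d d' :
  is_derive x v F d -> is_derive (F x) 1 h d' ->
  is_derive x v (fun y => h (F y)) (d' * d).
Proof.
move=> /is_derive_line dF dh; apply/is_derive_line.
apply: (@is_derive1_comp _ h (fun t : R => F (t *: v + x))).
by rewrite scale0r add0r.
Qed.

Section Ck.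
Variable n : nat.
Implicit Types (F G : 'rV[R]_n -> R) (x y : 'rV[R]_n) (i : 'I_n)
  (U V : set 'rV[R]_n) (k : nat).
Notation e i := (delta_mx 0 i : 'rV[R]_n).

(* smooth_on quantifies over sequences of partials; ck_on allows induction on
   the order of differentiability. *)
Fixpoint ck_on k U F : Prop :=
  (forall x, U x -> {for x, continuous F}) /\
  if k is k'.+1 then
    (forall x, U x -> forall i, derivable F x (e i)) /\
    forall i, ck_on k' U ('D_(e i) F)
  else True.

Lemma ck_onW k U F : ck_on k.+1 U F -> ck_on k U F.
Proof.
elim: k F => [|k IH] F; first by case.
by case=> cF [dF DF]; split => //; split => // i; exact: IH.
Qed.

Lemma open_near_eq U F G x : open U -> U x -> (forall y, U y -> F y = G y) ->
  {near x, F =1 G}.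
Proof.
move=> oU Ux FG; have : nbhs x U by exact: open_nbhs_nbhs.
exact: filterS.
Qed.

Lemma eq_ck_on k U F G : open U -> (forall x, U x -> F x = G x) ->
  ck_on k U F -> ck_on k U G.
Proof.
move=> oU; elim: k F G => [|k IH] F G FG /= [cF].
  move=> _; split => // x Ux.
  exact: near_eq_continuous (open_near_eq oU Ux FG) (cF x Ux).
move=> [dF DF]; split=> [x Ux|].
  exact: near_eq_continuous (open_near_eq oU Ux FG) (cF x Ux).
split=> [x Ux i|i].
  exact: near_eq_derivable (open_near_eq oU Ux FG) (dF x Ux i).
apply: IH (DF i) => x Ux; apply: near_eq_derive.
exact: open_near_eq oU Ux FG.
Qed.

(** [ck_on] peels off the derivative applied first to [F], which in [partials s F] is the last index
    of [s]; hence the induction from the right end of the sequence. *)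
Lemma smooth_onP U F : smooth_on U F <-> forall k, ck_on k U F.
Proof.
have partials_rcons s i G : partials (rcons s i) G = partials s ('D_(e i) G).
  by rewrite /partials foldr_rcons.
split=> [sF k|].
  elim: k F sF => [|k IH] F sF /=.
    by split => // x Ux; have [] := sF [::] x Ux.
  split=> [x Ux|]; first by have [] := sF [::] x Ux.
  split=> [x Ux i|i]; first by have [_] := sF [::] x Ux; apply.
  by apply: IH => s x Ux; rewrite -partials_rcons; exact: sF.
move=> ckF s; elim/last_ind: s F ckF => [|s i IH] F ckF.
  by move=> x Ux; have [cF [dF _]] := ckF 1%N; split; [exact: (cF x Ux)|exact: (dF x Ux)].
by rewrite partials_rcons; apply: IH => k; have [_ [_ D]] := ckF k.+1; exact: D.
Qed.

Lemma smooth_on_continuous U F x : smooth_on U F -> U x -> {for x, continuous F}.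
Proof. by move=> /(_ [::] x) + Ux => /(_ Ux)[]. Qed.

Lemma smooth_on_derivable U F x i : smooth_on U F -> U x -> derivable F x (e i).
Proof. by move=> /(_ [::] x) + Ux => /(_ Ux)[_]; apply. Qed.

Lemma smooth_on_derive U F i : smooth_on U F -> smooth_on U ('D_(e i) F).
Proof. by move=> /smooth_onP sF; apply/smooth_onP => k; have [_ [_ D]] := sF k.+1; exact: D. Qed.

Lemma eq_smooth_on U F G : open U -> (forall x, U x -> F x = G x) ->
  smooth_on U F -> smooth_on U G.
Proof.
by move=> oU FG /smooth_onP sF; apply/smooth_onP => k; exact: eq_ck_on (sF k).
Qed.

Lemma smooth_on_sub U V F : V `<=` U -> smooth_on U F -> smooth_on V F.
Proof. by move=> VU sF s x /VU; exact: sF. Qed.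

Lemma smooth_on_local U F :
  (forall x, U x -> exists V G, [/\ open V, V x, forall y, V y -> G y = F y &
     smooth_on V G]) ->
  smooth_on U F.
Proof.
move=> H s x /H[V [G [oV Vx GF sG]]].
exact: (eq_smooth_on oV GF sG).
Qed.

Lemma smooth_on_differentiable U F x : open U -> smooth_on U F -> U x ->
  differentiable F x.
Proof.
move=> oU sF Ux; apply: C1_differentiable => [|i].
  have : nbhs x U by exact: open_nbhs_nbhs.
  by apply: filterS => y Uy i; exact: smooth_on_derivable Uy.
exact: smooth_on_continuous (smooth_on_derive i sF) Ux.
Qed.

Lemma ck_on_cst k U (c : R) : ck_on k U (fun=> c).
Proof.
elim: k c => [|k IH] c /=; first by split => // x _; exact: cst_continuous.
split=> [x _|]; first exact: cst_continuous.
split=> [x _ i|i]; first exact: derivable_cst.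
by rewrite (_ : 'D_(e i) _ = fun=> 0) //; apply/funext => x; rewrite derive_cst.
Qed.

Lemma ck_on_add k U F G : open U -> ck_on k U F -> ck_on k U G ->
  ck_on k U (fun x => F x + G x).
Proof.
move=> oU; elim: k F G => [|k IH] F G /= [cF +] [cG].
  by move=> _ _; split => // x Ux; apply: continuousD; [exact: cF|exact: cG].
move=> [dF DF] [dG DG].
split=> [x Ux|]; first by apply: continuousD; [exact: cF|exact: cG].
split=> [x Ux i|i]; first by apply: derivableD; [exact: dF|exact: dG].
apply: eq_ck_on (IH _ _ (DF i) (DG i)) => // x Ux.
by rewrite (@deriveD _ _ _ F G) //; [exact: dF|exact: dG].
Qed.

Lemma ck_on_mul k U F G : open U -> ck_on k U F -> ck_on k U G ->
  ck_on k U (fun x => F x * G x).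
Proof.
move=> oU; elim: k F G => [|k IH] F G ckF ckG.
  by split => // x Ux; apply: continuousM; [exact: (ckF.1)|exact: (ckG.1)].
have [cF [dF DF]] := ckF; have [cG [dG DG]] := ckG.
split=> [x Ux|]; first by apply: continuousM; [exact: cF|exact: cG].
split=> [x Ux i|i]; first by apply: derivableM; [exact: dF|exact: dG].
apply: eq_ck_on (ck_on_add oU (IH _ _ (ck_onW ckF) (DG i))
  (IH _ _ (ck_onW ckG) (DF i))) => // x Ux.
by rewrite (@deriveM _ _ F G) //; [exact: dF|exact: dG].
Qed.

Lemma smooth_on_cst U (c : R) : smooth_on U (fun=> c).
Proof. by apply/smooth_onP => k; exact: ck_on_cst. Qed.

Lemma smooth_on_add U F G : open U -> smooth_on U F -> smooth_on U G ->
  smooth_on U (fun x => F x + G x).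
Proof.
by move=> oU /smooth_onP sF /smooth_onP sG; apply/smooth_onP => k; exact: ck_on_add.
Qed.

Lemma smooth_on_mul U F G : open U -> smooth_on U F -> smooth_on U G ->
  smooth_on U (fun x => F x * G x).
Proof.
by move=> oU /smooth_onP sF /smooth_onP sG; apply/smooth_onP => k; exact: ck_on_mul.
Qed.

Lemma smooth_on_sum (I : Type) (r : seq I) (P : pred I) U (F : I -> 'rV[R]_n -> R) :
  open U -> (forall j, P j -> smooth_on U (F j)) ->
  smooth_on U (fun x => \sum_(j <- r | P j) F j x).
Proof.
move=> oU sF; elim: r => [|j r IH].
  by apply: (eq_smooth_on oU _ (@smooth_on_cst U 0)) => // x _; rewrite big_nil.
case Pj: (P j).
  apply: (eq_smooth_on oU _ (smooth_on_add oU (sF j Pj) IH)) => // x _.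
  by rewrite big_cons Pj.
by apply: (eq_smooth_on oU _ IH) => // x _; rewrite big_cons Pj.
Qed.

Lemma smooth_on_prod (I : Type) (r : seq I) (P : pred I) U (F : I -> 'rV[R]_n -> R) :
  open U -> (forall j, P j -> smooth_on U (F j)) ->
  smooth_on U (fun x => \prod_(j <- r | P j) F j x).
Proof.
move=> oU sF; elim: r => [|j r IH].
  by apply: (eq_smooth_on oU _ (@smooth_on_cst U 1)) => // x _; rewrite big_nil.
case Pj: (P j).
  apply: (eq_smooth_on oU _ (smooth_on_mul oU (sF j Pj) IH)) => // x _.
  by rewrite big_cons Pj.
by apply: (eq_smooth_on oU _ IH) => // x _; rewrite big_cons Pj.
Qed.

Lemma smooth_on_coord U i : smooth_on U (fun x => x 0 i).
Proof.
have dX j x : is_derive x (e j) (fun x => x 0 i) ((j == i)%:R).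
  have did := @derivable_id R 'rV[R]_n x (e j).
  split; first by move/derivable_mxP: (did); apply.
  have := derive_mx did; rewrite derive_id.
  by move=> /matrixP /(_ 0 i); rewrite !mxE eqxx /= eq_sym => <-.
have cX x : {for x, continuous (fun x : 'rV[R]_n => x 0 i)}.
  exact/differentiable_continuous/differentiable_coord.
apply/smooth_onP => -[|k] /=.
  by split => // x _; exact: cX.
split=> [x _|]; first exact: cX.
split=> [x _ j|j]; first by case: (dX j x).
rewrite (_ : 'D_(e j) _ = fun=> (j == i)%:R : R); first exact: ck_on_cst.
by apply/funext => x; have [_ ->] := dX j x.
Qed.

Lemma smooth_on_scale U (c : R) F : open U -> smooth_on U F ->
  smooth_on U (fun x => c * F x).
Proof. by move=> oU; apply: smooth_on_mul => //; exact: smooth_on_cst. Qed.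

Lemma smooth_on_opp U F : open U -> smooth_on U F -> smooth_on U (fun x => - F x).
Proof.
move=> oU /(smooth_on_scale (-1) oU); apply: eq_smooth_on => // x _.
by rewrite mulN1r.
Qed.

(** The derivative of [1/F] is [- F' (1/F)^2], so order [k] for [1/F] itself yields order [k.+1]. *)
Lemma smooth_on_inv U F : open U -> (forall x, U x -> F x != 0) ->
  smooth_on U F -> smooth_on U (fun x => (F x)^-1).
Proof.
move=> oU F0 sF; apply/smooth_onP.
have cV x : U x -> {for x, continuous (fun x => (F x)^-1)}.
  move=> Ux; apply: continuousV; first exact: F0.
  exact: smooth_on_continuous sF Ux.
elim=> [|k IH]; first by split.
split => //; split=> [x Ux i|i].
  by apply: derivableV; [exact: F0|exact: smooth_on_derivable sF Ux].
have /smooth_onP/(_ k) sD := smooth_on_opp oU (smooth_on_derive i sF).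
apply: eq_ck_on (ck_on_mul oU sD (ck_on_mul oU IH IH)) => // x Ux.
rewrite (@deriveV _ _ F) ?F0 //; last exact: smooth_on_derivable sF Ux.
by rewrite -exprVn -[RHS]/(- _ * _); ring.
Qed.

(** Bootstrapping on the equation [D_i G = H_i G]: the right side has as many derivatives as [G], so
    [G] gains one order at each turn. It serves [exp F] with [H_i = D_i F] and the root of [|F|]
    with [H_i = D_i F / (2 F)]. *)
Lemma smooth_on_log_derivative U G (H : 'I_n -> 'rV[R]_n -> R) :
  open U -> (forall x, U x -> {for x, continuous G}) ->
  (forall x i, U x -> is_derive x (e i) G (H i x * G x)) ->
  (forall i, smooth_on U (H i)) -> smooth_on U G.
Proof.
move=> oU cG dG sH; apply/smooth_onP; elim=> [|k IH]; first by split.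
split => //; split=> [x Ux i|i]; first by case: (dG x i Ux).
have /smooth_onP/(_ k) sD := sH i.
apply: eq_ck_on (ck_on_mul oU sD IH) => // x Ux.
by have [_ ->] := dG x i Ux.
Qed.

Lemma smooth_on_expR U F : open U -> smooth_on U F -> smooth_on U (fun x => expR (F x)).
Proof.
move=> oU sF; apply: (@smooth_on_log_derivative _ _ (fun i => 'D_(e i) F) oU).
- move=> x Ux; apply: (@continuous_comp _ _ _ F expR).
    exact: smooth_on_continuous sF Ux.
  exact: continuous_expR.
- move=> x i Ux; rewrite mulrC; apply: is_derive_comp.
  by apply: derivableP; exact: smooth_on_derivable sF Ux.
- by move=> i; exact: smooth_on_derive.
Qed.

Lemma smooth_on_sqrt_norm U F : open U -> (forall x, U x -> F x != 0) ->
  smooth_on U F -> smooth_on U (fun x => Num.sqrt `|F x|).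
Proof.
move=> oU F0 sF.
(* [F] keeps its sign near a point where it is nonzero, so [|F|] is locally a constant multiple of
   [F]. *)
have nearE x : U x -> \forall y \near x, `|F y| = Num.sg (F x) * F y.
  move=> Ux; have cF := smooth_on_continuous sF Ux.
  have [F0x|F0x|/eqP] := ltgtP (F x) 0; last by rewrite (negPf (F0 x Ux)).
  - rewrite ltr0_sg //; have := cF => /cvgr_lt /(_ _ F0x); apply: filterS => y Fy.
    by rewrite ltr0_norm // mulN1r.
  - rewrite gtr0_sg //; have := cF => /cvgr_gt /(_ _ F0x); apply: filterS => y Fy.
    by rewrite gtr0_norm // mul1r.
apply: (@smooth_on_log_derivative _ _ (fun i x => 2^-1 * ((F x)^-1 * 'D_(e i) F x)) oU).
- move=> x Ux; apply: (@continuous_comp _ _ _ (fun x => `|F x|) Num.sqrt).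
    apply: (@continuous_comp _ _ _ F); first exact: smooth_on_continuous sF Ux.
    exact: norm_continuous.
  exact: sqrt_continuous.
- move=> x i Ux.
  have dN : is_derive x (e i) (fun y => `|F y|) (Num.sg (F x) * 'D_(e i) F x).
    apply: (@near_eq_is_derive _ _ _ (fun y => Num.sg (F x) *: F y)).
      by apply: filterS (nearE x Ux) => y ->.
    apply: is_deriveZ; apply: derivableP; exact: smooth_on_derivable sF Ux.
  have N0 : 0 < `|F x| by rewrite normr_gt0 F0.
  have := is_derive_comp dN (is_derive1_sqrt N0).
  move/is_derive_eq; apply.
  have S0 : Num.sqrt `|F x| != 0 by rewrite gt_eqF // sqrtr_gt0.
  have Fx0 := F0 x Ux.
  have SS : Num.sqrt `|F x| * Num.sqrt `|F x| = Num.sg (F x) * F x.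
    by rewrite -expr2 sqr_sqrtr // -normrEsg.
  apply: (mulfI S0); apply: (mulfI Fx0).
  rewrite [RHS](_ : _ = 2^-1 * (F x * (F x)^-1) * 'D_(e i) F x *
    (Num.sqrt `|F x| * Num.sqrt `|F x|)); last by ring.
  rewrite SS mulfV // invfM.
  rewrite [LHS](_ : _ = 2^-1 * Num.sg (F x) * 'D_(e i) F x * F x *
    (Num.sqrt `|F x| * (Num.sqrt `|F x|)^-1)); last by ring.
  by rewrite mulfV //; ring.
- move=> i; apply: (smooth_on_scale _ oU); apply: (smooth_on_mul oU).
    exact: (smooth_on_inv oU F0 sF).
  exact: (smooth_on_derive i sF).
Qed.

End Ck.
End SmoothFunctions.

(** * Composition and matrix-valued smooth functions *)

Section Composition.
Variable R : realType.
Notation e i := (delta_mx 0 i).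

Lemma diff_rowE m (V : normedModType R) (h : 'rV[R]_m -> V) y (v : 'rV[R]_m) :
  differentiable h y -> 'd h y v = \sum_j v 0 j *: 'D_(e j) h y.
Proof.
move=> dh; rewrite {1}[v]row_sum_delta linear_sum /=.
by apply: eq_bigr => j _; rewrite linearZ /= deriveE.
Qed.

Lemma differentiable_row m (V : normedModType R) (phi : V -> 'rV[R]_m) x :
  (forall j, differentiable (fun y => phi y 0 j) x) -> differentiable phi x.
Proof.
move=> dphi.
have -> : phi = \sum_j (fun y => phi y 0 j *: e j).
  by apply/funext => y; rewrite fct_sumE /= {1}[phi y]row_sum_delta.
by apply: differentiable_sum => j; exact: differentiableZl.
Qed.

(** Induction on the order, for all [h] simultaneously: the chain rule produces the functions
    [D_j h] composed with [phi], to which the induction hypothesis must apply. *)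
Lemma smooth_on_comp n m (U : set 'rV[R]_n) (V : set 'rV[R]_m)
    (phi : 'rV[R]_n -> 'rV[R]_m) (h : 'rV[R]_m -> R) :
  open U -> open V -> (forall x, U x -> V (phi x)) ->
  (forall j, smooth_on U (fun x => phi x 0 j)) -> smooth_on V h ->
  smooth_on U (fun x => h (phi x)).
Proof.
move=> oU oV UV sphi sh; apply/smooth_onP => k.
have dphi x : U x -> differentiable phi x.
  move=> Ux; apply: differentiable_row => j.
  exact: smooth_on_differentiable oU (sphi j) Ux.
have dh y : V y -> forall (g : 'rV[R]_m -> R), smooth_on V g -> differentiable g y.
  by move=> Vy g sg; exact: smooth_on_differentiable oV sg Vy.
elim: k h sh => [|k IH] h sh.
  split=> // x Ux; apply: (@continuous_comp _ _ _ phi h).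
    exact: differentiable_continuous (dphi x Ux).
  exact: smooth_on_continuous sh (UV x Ux).
have dcomp x : U x -> differentiable (fun x => h (phi x)) x.
  move=> Ux; apply: (@differentiable_comp _ _ _ _ phi h); first exact: dphi.
  by apply: dh => //; exact: UV.
split=> [x Ux|]; first exact: differentiable_continuous (dcomp x Ux).
split=> [x Ux i|i]; first exact: diff_derivable (dcomp x Ux).
have E x : U x -> \sum_j 'D_(e j) h (phi x) * 'D_(e i) (fun x => phi x 0 j) x
    = 'D_(e i) (fun x => h (phi x)) x.
  move=> Ux; rewrite deriveE; last exact: dcomp.
  rewrite (@diff_comp _ _ _ _ phi h) /=; [|exact: dphi|by apply: dh => //; exact: UV].
  rewrite diff_rowE; last by apply: dh => //; exact: UV.
  rewrite -deriveE; last exact: dphi.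
  apply: eq_bigr => j _; rewrite derive_mx; last exact: diff_derivable (dphi x Ux).
  by rewrite mxE mulrC.
apply: (eq_ck_on oU E).
elim: (index_enum _) => [|j r IHr].
  by apply: (eq_ck_on oU _ (@ck_on_cst _ _ k U 0)) => x _; rewrite big_nil.
have /smooth_onP/(_ k) s1 := smooth_on_derive i (sphi j).
have s2 := IH _ (smooth_on_derive j sh).
apply: (eq_ck_on oU _ (ck_on_add oU (ck_on_mul oU s2 s1) IHr)) => x _.
by rewrite big_cons.
Qed.

Lemma smooth_on_det n m (U : set 'rV[R]_n) (A : 'rV[R]_n -> 'M[R]_m) :
  open U -> (forall i j, smooth_on U (fun x => A x i j)) ->
  smooth_on U (fun x => \det (A x)).
Proof.
move=> oU sA; apply: (smooth_on_sum _ oU) => s _.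
apply: (smooth_on_scale _ oU); apply: (smooth_on_prod _ oU) => i _; exact: sA.
Qed.

Lemma smooth_on_adj n m (U : set 'rV[R]_n) (A : 'rV[R]_n -> 'M[R]_m) :
  open U -> (forall i j, smooth_on U (fun x => A x i j)) ->
  forall i j, smooth_on U (fun x => (\adj (A x)) i j).
Proof.
move=> oU sA i j.
have s : smooth_on U (fun x => (-1) ^+ (j + i) * \det (row' j (col' i (A x)))).
  apply: (smooth_on_scale _ oU); apply: (smooth_on_det oU) => k l.
  by apply: (eq_smooth_on oU _ (sA (lift j k) (lift i l))) => x _; rewrite !mxE.
by apply: (eq_smooth_on oU _ s) => x _; rewrite mxE.
Qed.

Lemma smooth_on_invmx n m (U : set 'rV[R]_n) (A : 'rV[R]_n -> 'M[R]_m) :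
  open U -> (forall i j, smooth_on U (fun x => A x i j)) ->
  (forall x, U x -> A x \in unitmx) ->
  forall i j, smooth_on U (fun x => (invmx (A x)) i j).
Proof.
move=> oU sA uA i j.
have s : smooth_on U (fun x => (\det (A x))^-1 * (\adj (A x)) i j).
  apply: (smooth_on_mul oU); last exact: smooth_on_adj.
  apply: (smooth_on_inv oU) => [x /uA|]; first by rewrite unitmxE unitfE.
  exact: smooth_on_det.
by apply: (eq_smooth_on oU _ s) => x Ux; rewrite /invmx uA // [RHS]mxE.
Qed.

End Composition.

(** * Smooth bump functions *)

Section Bump.
Variable R : realType.

(** The powers of [x^-1] are included so that the family is closed under differentiation up to
    linear combinations; smoothness of all members is then proved by one induction. *)
Definition flat (k : nat) (x : R) : R := if 0 < x then x^-1 ^+ k * expR (- x^-1) else 0.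

(** One term of the exponential series, [y^(k+2) / (k+2)! <= exp y] at [y = 1/x]. Of the two extra
    powers of [x], one is spent on the difference quotient at 0 and the other makes it tend to 0. *)
Lemma flat_le k (x : R) : 0 < x -> flat k x <= (k.+2)`!%:R * x ^+ 2.
Proof.
move=> x0; rewrite /flat x0 expRN.
have xi0 : 0 < x^-1 by rewrite invr_gt0.
have f0 : (0 : R) < (k.+2)`!%:R by rewrite ltr0n fact_gt0.
have E : (x^-1) ^+ k.+2 / (k.+2)`!%:R <= expR x^-1.
  by apply: le_trans (expR_ge1Dxn k.+1 (ltW xi0)); rewrite lerDr.
rewrite ler_pdivrMr ?expR_gt0 //.
have := ler_wpM2l (ltW (mulr_gt0 f0 (exprn_gt0 2 x0))) E.
apply: le_trans; rewrite le_eqVlt; apply/orP; left; apply/eqP.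
rewrite -[k.+2]addn2 exprD addn2.
rewrite [RHS](_ : _ = x^-1 ^+ k * (x^-1 ^+ 2 * x ^+ 2) *
   ((k.+2)`!%:R / (k.+2)`!%:R)); last by ring.
by rewrite -exprMn mulVf ?gt_eqF // expr1n mulr1 divff ?gt_eqF // mulr1.
Qed.

Lemma is_derive_flat k (x : R) :
  is_derive x 1 (flat k) (- k%:R * flat k.+1 x + flat k.+2 x).
Proof.
have [x0|x0|x0] := ltgtP x 0.
- have E : \forall y \near x, (fun=> 0) y = flat k y.
    near=> y; have y0 : y < 0 by near: y; exact: lt_nbhsl.
    by rewrite /flat ltNge (ltW y0).
  apply: near_eq_is_derive E _.
  rewrite /flat ltNge (ltW x0) /= mulr0 addr0; exact: is_derive_cst.
- have E : \forall y \near x, (fun y => y^-1 ^+ k * expR (- y^-1)) y = flat k y.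
    near=> y; have y0 : 0 < y by near: y; exact: lt_nbhsr.
    by rewrite /flat y0.
  apply: near_eq_is_derive E _.
  have xn0 : x != 0 by rewrite gt_eqF.
  have dV : is_derive x 1 (fun y : R => y^-1) (- x^-1 ^+ 2).
    split; first exact: (@derivableV _ _ id).
    rewrite (@deriveV _ _ id) // derive_id -exprVn; exact: mulr1.
  have dX : is_derive x 1 (fun y : R => y^-1 ^+ k) (- k%:R * x^-1 ^+ k.+1).
    case: k => [|k].
      by rewrite oppr0 mul0r; exact: is_derive_cst.
    rewrite (_ : (fun y : R => _) = (fun y : R => y^-1) ^+ k.+1); last first.
      by apply/funext => y; rewrite exprfctE.
    apply: is_derive_eq (is_deriveX k.+1 dV) _.
    by rewrite -[LHS]/(_ * _) !exprS; ring.
  have dE := is_derive_comp (is_deriveN dV) (is_derive_expR (- x^-1)).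
  have := is_deriveM dX dE; move/is_derive_eq; apply.
  rewrite /flat x0 -[LHS]/(_ * _ + _ * _) !exprS; ring.
- rewrite x0 /flat ltxx mulr0 addr0 -/(flat k).
  (* For [h > 0] the quotient is at most [(k+2)! h] by [flat_le]; for [h < 0] it vanishes. *)
  have C : (fun h : R => h^-1 *: (flat k (h *: 1 + 0) - flat k 0)) @ 0^' --> (0 : R).
    apply/cvgr0Pnorm_le => eps eps0.
    near=> h.
    rewrite addr0 [h *: 1]mulr1 /flat ltxx subr0.
    case: ifPn => h0; last by rewrite scaler0 normr0 ltW.
    have := flat_le k h0; rewrite {1}/flat h0 => H.
    rewrite normrZ normfV (gtr0_norm h0) ger0_norm; last first.
      by rewrite mulr_ge0 ?expR_ge0 // exprn_ge0 // invr_ge0 ltW.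
    rewrite ler_pdivrMl //; apply: le_trans H _.
    rewrite expr2 mulrCA ler_wpM2l ?(ltW h0) //.
    rewrite -ler_pdivlMl ?ltr0n ?fact_gt0 // -(gtr0_norm h0).
    near: h; apply: dnbhs0_le; rewrite mulr_gt0 // invr_gt0 ltr0n fact_gt0 //.
  split; first by apply/cvg_ex; exists 0.
  exact/cvg_lim.
Unshelve. all: by end_near. Qed.

Lemma smooth_on_flat n (U : set 'rV[R]_n) (F : 'rV[R]_n -> R) k :
  open U -> smooth_on U F -> smooth_on U (fun x => flat k (F x)).
Proof.
move=> oU sF; apply/smooth_onP => m.
have dflat j x i : U x -> is_derive x (delta_mx 0 i) (fun x => flat j (F x))
    ((- j%:R * flat j.+1 (F x) + flat j.+2 (F x)) * 'D_(delta_mx 0 i) F x).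
  move=> Ux; apply: is_derive_comp (is_derive_flat j (F x)).
  by apply: derivableP; exact: smooth_on_derivable sF Ux.
have cflat j x : U x -> {for x, continuous (fun x => flat j (F x))}.
  move=> Ux; apply: (@continuous_comp _ _ _ F); first exact: smooth_on_continuous sF Ux.
  apply/differentiable_continuous/derivable1_diffP.
  by case: (is_derive_flat j (F x)).
elim: m k => [|m IH] k; first by split=> // x; exact: cflat.
split=> [x|]; first exact: cflat.
split=> [x Ux i|i]; first by case: (dflat k x i Ux).
have /smooth_onP/(_ m) sD := smooth_on_derive i sF.
have c := @ck_on_cst _ _ m U (- k%:R).
apply: (eq_ck_on oU _ (ck_on_mul oU (ck_on_add oU (ck_on_mul oU c (IH k.+1)) (IH k.+2)) sD)).
by move=> x Ux; have [_ ->] := dflat k x i Ux.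
Qed.

(** The norm on rows is the maximum norm, so a product of one-variable bumps is supported in a ball
    for that norm. *)
Definition bump n (c : 'rV[R]_n) (r : R) (x : 'rV[R]_n) : R :=
  \prod_i flat 0 (r ^+ 2 - (x 0 i - c 0 i) ^+ 2).

Lemma smooth_on_bump n (U : set 'rV[R]_n) c r : open U -> smooth_on U (bump c r).
Proof.
move=> oU; apply: (smooth_on_prod _ oU) => i _; apply: (smooth_on_flat _ oU).
have sX : smooth_on U (fun x : 'rV[R]_n => x 0 i - c 0 i).
  by apply: (smooth_on_add oU); [exact: smooth_on_coord|exact: smooth_on_cst].
apply: (smooth_on_add oU); first exact: smooth_on_cst.
exact: (smooth_on_opp oU (smooth_on_mul oU sX sX)).
Qed.

Lemma bump_center n (c : 'rV[R]_n) r : 0 < r -> bump c r c != 0.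
Proof.
move=> r0; rewrite gt_eqF //; apply: prodr_gt0 => i _.
by rewrite subrr expr0n subr0 /flat exprn_gt0 // expr0 mul1r expR_gt0.
Qed.

Lemma bump_support n (c : 'rV[R]_n) r x : 0 < r -> bump c r x != 0 -> `|x - c| <= r.
Proof.
move=> r0 /prodf_neq0 H; apply: norm_le_coord => [|i]; first exact: ltW.
have := H i isT; rewrite /flat; case: ifP => [|_ /eqP //].
rewrite subr_gt0 !mxE => /ltW le _.
by rewrite -ler_sqr ?nnegrE ?(ltW r0) // real_normK ?num_real.
Qed.

End Bump.

(** * Charts *)

Section NearEqDiff.
Variables (R : realType) (V W : normedModType R).

Lemma near_eq_diff (f h : V -> W) x : {near x, f =1 h} -> differentiable f x ->
  differentiable h x /\ 'd h x = 'd f x :> (V -> W).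
Proof.
move=> fh df.
have c : continuous ('d f x) by exact: diff_continuous.
have E : forall eps : R, 0 < eps -> \forall k \near (0 : V),
    `|h (k + x) - (h x + 'd f x k)| <= eps * `|k|.
  move=> eps eps0.
  have /diff_locallyP[_ /eqaddoP/(_ _ eps0)] := df.
  have fh0 : \forall k \near (0 : V), f (k + x) = h (k + x).
    have : \forall y \near x, f y = h y by exact: fh.
    by rewrite (near_shift 0) subr0.
  apply: filterS2 fh0 => k /= <-; rewrite -(nbhs_singleton fh); exact.
have D : 'd h x = 'd f x :> (_ -> _).
  by apply: diff_unique => //; apply/eqaddoP.
split; last exact: D.
apply/diff_locallyP; rewrite D; split; first exact: c.
exact/eqaddoP.
Qed.

End NearEqDiff.

Section Charts.
Variables (R : realType) (n : nat) (T : topologicalType).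
Implicit Types (a b c : chart R n T) (p q : T).
Notation e i := (delta_mx 0 i : 'rV[R]_n).

Definition chart_image a : set 'rV[R]_n := coord a @` dom a.

Definition overlap a b : set 'rV[R]_n := coord a @` (dom a `&` dom b).

Lemma chart_imageP a x : chart_image a x -> dom a (param a x) /\ coord a (param a x) = x.
Proof. by case=> p ap <-; rewrite coordK. Qed.

Lemma coord_image a p : dom a p -> chart_image a (coord a p).
Proof. by move=> ap; exists p. Qed.

Lemma open_coord_image a (W : set T) : open W -> open (coord a @` (dom a `&` W)).
Proof.
move=> oW.
have -> : coord a @` (dom a `&` W) = chart_image a `&` param a @^-1` W.
  apply/seteqP; split=> [x [p [ap Wp] <-]|x [/chart_imageP[ax xE] Wx]].
    by split; [exact: coord_image|rewrite /= coordK].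
  by exists (param a x).
have := @param_continuous _ _ _ a; rewrite continuous_open_subspace; last exact: image_open.
by move/continuous_inP; apply => //; exact: image_open.
Qed.

Lemma open_overlap a b : open (overlap a b).
Proof. by apply: open_coord_image; exact: dom_open. Qed.

Lemma coord_overlap a b p : dom a p -> dom b p -> overlap a b (coord a p).
Proof. by exists p. Qed.

Lemma near_param a p (W : set T) : dom a p -> open W -> W p ->
  \forall y \near coord a p, W (param a y) /\ dom a (param a y) /\ coord a (param a y) = y.
Proof.
move=> ap oW Wp.
have : nbhs (coord a p) (coord a @` (dom a `&` W)).
  by apply: open_nbhs_nbhs; split; [exact: open_coord_image|exists p].
by apply: filterS => y [q [aq Wq] <-]; rewrite coordK.
Qed.

Lemma transitionE a b p : dom a p -> transition a b (coord a p) = coord b p.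
Proof. by move=> ap; rewrite /transition /= coordK. Qed.

Lemma transition_differentiable a b p : smooth_transition a b -> dom a p -> dom b p ->
  differentiable (transition a b) (coord a p).
Proof.
move=> sab ap bp; apply: differentiable_row => j.
exact: (smooth_on_differentiable (@open_overlap a b) (sab j) (coord_overlap ap bp)).
Qed.

Lemma diff_transition a b p v : differentiable (transition a b) (coord a p) ->
  'd (transition a b) (coord a p) v = v *m jac a b p.
Proof. by move=> d; rewrite /jac /jacobian mul_rV_lin1. Qed.

(** Chain rule, with the factors in the order of the transitions because vectors are rows. The
    composite of transitions agrees with [transition a c] only near [coord a p], and
    differentiability of the latter is deduced from this local equality. *)
Lemma jac_comp a b c p : smooth_transition a b -> smooth_transition b c ->
  dom a p -> dom b p -> dom c p -> jac a c p = jac a b p *m jac b c p.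
Proof.
move=> sab sbc ap bp cp.
have dab := transition_differentiable sab ap bp.
have dbc := transition_differentiable sbc bp cp.
have dbc' : differentiable (transition b c) (transition a b (coord a p)).
  by rewrite transitionE.
have dcomp := differentiable_comp dab dbc'.
have nE : {near coord a p, transition b c \o transition a b =1 transition a c}.
  apply: filterS (near_param ap (@dom_open _ _ _ b) bp) => y [by_ _].
  by rewrite /transition /= coordK.
have [dac Dac] := near_eq_diff nE dcomp.
have E (v : 'rV[R]_n) : v *m jac a c p = v *m (jac a b p *m jac b c p).
  apply: etrans (esym (diff_transition v dac)) _.
  apply: etrans (congr1 (fun h : 'rV[R]_n -> 'rV[R]_n => h v) Dac) _.
  apply: etrans (congr1 (fun h : 'rV[R]_n -> 'rV[R]_n => h v) (diff_comp dab dbc')) _.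
  rewrite /= (transitionE _ ap) mulmxA -(diff_transition v dab).
  exact: diff_transition.
by apply/row_matrixP => i; rewrite !rowE E.
Qed.

Lemma jac_id a p : dom a p -> jac a a p = 1%:M.
Proof.
move=> ap.
have nE : {near coord a p, id =1 transition a a}.
  by apply: filterS (near_param ap (@dom_open _ _ _ a) ap) => y [_ [_]]; rewrite /transition /=.
have [did Did] := @is_diff_id R 'rV[R]_n (coord a p).
have [d D] := near_eq_diff nE did.
apply/row_matrixP => i; rewrite !rowE mulmx1.
by apply: etrans (esym (diff_transition _ d)) _; rewrite D Did.
Qed.

Lemma jacK a b p : smooth_transition a b -> smooth_transition b a ->
  dom a p -> dom b p -> jac a b p *m jac b a p = 1%:M.
Proof. by move=> sab sba ap bp; rewrite -jac_comp // jac_id. Qed.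

Lemma jac_entry a b p i j : differentiable (transition a b) (coord a p) ->
  jac a b p i j = 'D_(e i) (fun x => transition a b x 0 j) (coord a p).
Proof.
move=> d; have := derive_mx (@diff_derivable _ _ _ _ _ (e i) d).
rewrite (deriveE _ d) (diff_transition _ d) -rowE => /rowP/(_ j).
by rewrite !mxE.
Qed.

Lemma smooth_on_jac_source a b i j : smooth_transition a b ->
  smooth_on (overlap a b) (fun x => jac a b (param a x) i j).
Proof.
move=> sab; have s := smooth_on_derive i (sab j).
apply: (eq_smooth_on (@open_overlap a b) _ s) => x [q [aq bq] <-].
rewrite coordK // jac_entry //; exact: transition_differentiable.
Qed.

(** Here the Jacobian is read in its target chart [b]: the source version is precomposed with
    [transition b a]. *)
Lemma smooth_on_jac a b i j : smooth_transition a b -> smooth_transition b a ->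
  smooth_on (overlap b a) (fun y => jac a b (param b y) i j).
Proof.
move=> sab sba.
have ov x : overlap b a x -> overlap a b (transition b a x).
  by move=> [q [bq aq] <-]; rewrite transitionE //; exact: coord_overlap.
have sc := smooth_on_comp (@open_overlap b a) (@open_overlap a b) ov sba
  (smooth_on_jac_source i j sab).
apply: (eq_smooth_on (@open_overlap b a) _ sc) => x [q [bq aq] <-].
by rewrite (transitionE _ bq) (coordK aq) (coordK bq).
Qed.

End Charts.

(* Keeps unification from comparing distinct jacobians by unfolding. *)
Local Opaque jac.

(** * Vector fields, differentials and cut-off frames in charts *)

Section ManifoldCalculus.
Variables (R : realType) (n : nat) (M : manifold R n).
Implicit Types (a b c : chart R n M) (p q : M) (X Y Z : vector_field M) (h : M -> R).
Notation e i := (delta_mx 0 i : 'rV[R]_n).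

Definition components a X p : 'rV[R]_n := X p *m jac (chart_at p) a p.

Definition partial_row a h p : 'rV[R]_n :=
  \row_j 'D_(e j) (h \o param a) (coord a p).

Lemma jac_atlasK a b p : atlas a -> atlas b -> dom a p -> dom b p ->
  jac a b p *m jac b a p = 1%:M.
Proof. by move=> aa ab; apply: jacK; exact: atlas_smooth. Qed.

Lemma componentsK a X p : atlas a -> dom a p ->
  components a X p *m jac a (chart_at p) p = X p.
Proof.
move=> aa ap; rewrite /components -mulmxA jac_atlasK ?mulmx1 //.
- exact: chart_at_atlas.
- exact: chart_at_dom.
Qed.

Lemma components_chart_at X p : components (chart_at p) X p = X p.
Proof. by rewrite /components jac_id ?mulmx1 //; exact: chart_at_dom. Qed.

Lemma smooth_in_chart_differentiable a h p : smooth_in_chart a h -> dom a p ->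
  differentiable (h \o param a) (coord a p).
Proof.
move=> sh ap; exact: (smooth_on_differentiable (@image_open _ _ _ a) sh (coord_image ap)).
Qed.

Lemma eq_smooth_in_chart a h h' : (forall q, dom a q -> h q = h' q) ->
  smooth_in_chart a h -> smooth_in_chart a h'.
Proof.
move=> E; apply: eq_smooth_on; first exact: image_open.
by move=> x [q aq <-]; rewrite /= coordK // E.
Qed.

Lemma smooth_in_chart_local a h :
  (forall q, dom a q -> exists W G, [/\ open W, W q,
     forall q', dom a q' -> W q' -> G (coord a q') = h q' &
     smooth_on (coord a @` (dom a `&` W)) G]) ->
  smooth_in_chart a h.
Proof.
move=> H; apply: smooth_on_local => x [q aq <-].
have [W [G [oW Wq GE sG]]] := H q aq.
exists (coord a @` (dom a `&` W)), G; split.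
- exact: open_coord_image.
- by exists q.
- by move=> y [q' [aq' Wq'] <-]; rewrite /= coordK // GE.
- exact: sG.
Qed.

(** [dfun] is defined through [chart_at p], which may jump with [p]; smoothness in [p] requires this
    expression in one fixed chart [a]. *)
Lemma dfun_diff a h p v : atlas a -> dom a p ->
  differentiable (h \o param a) (coord a p) ->
  dfun h p v = 'd (h \o param a) (coord a p) (v *m jac (chart_at p) a p).
Proof.
move=> aa ap dh.
have cp := chart_at_dom p.
have dT := transition_differentiable (atlas_smooth (chart_at_atlas p) aa) cp ap.
have dh' : differentiable (h \o param a) (transition (chart_at p) a (coord (chart_at p) p)).
  by rewrite transitionE.
have nE : {near coord (chart_at p) p,
    (h \o param a) \o transition (chart_at p) a =1 h \o param (chart_at p)}.
  apply: filterS (near_param cp (@dom_open _ _ _ a) ap) => y [ay _].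
  by rewrite /transition /= coordK.
have [_ D] := near_eq_diff nE (differentiable_comp dT dh').
apply: etrans (congr1 (fun k : 'rV[R]_n -> R => k v) D) _.
apply: etrans (congr1 (fun k : 'rV[R]_n -> R => k v) (diff_comp dT dh')) _.
by rewrite /= (transitionE _ cp) (diff_transition _ dT).
Qed.

Lemma dfunE a h p v : atlas a -> dom a p -> differentiable (h \o param a) (coord a p) ->
  dfun h p v = \sum_j (v *m jac (chart_at p) a p) 0 j * partial_row a h p 0 j.
Proof.
move=> aa ap dh; rewrite (dfun_diff _ aa ap dh) (diff_rowE _ dh).
by apply: eq_bigr => j _; apply: (congr1 ( *%R _)); rewrite mxE.
Qed.

Lemma smooth_partial a h j : smooth_in_chart a h ->
  smooth_in_chart a (fun p => partial_row a h p 0 j).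
Proof.
move=> sh; have s := smooth_on_derive j sh.
apply: (eq_smooth_on (@image_open _ _ _ a) _ s) => x /chart_imageP[_ xE].
by rewrite /= mxE xE.
Qed.

Lemma smooth_deriv_along a h X : atlas a -> smooth_in_chart a h -> smooth_field X ->
  smooth_in_chart a (deriv_along X h).
Proof.
move=> aa sh sX.
have oa := @image_open _ _ _ a.
have s : smooth_in_chart a (fun p => \sum_j components a X p 0 j * partial_row a h p 0 j).
  apply: (smooth_on_sum _ oa) => j _.
  by apply: (smooth_on_mul oa); [exact: sX|exact: smooth_partial].
apply: eq_smooth_in_chart s => q aq.
by rewrite /deriv_along (dfunE _ aa aq) //; exact: smooth_in_chart_differentiable.
Qed.

(** The coordinate frame of [chart_at p] is multiplied by a bump and extended by zero. The scalar
    [b] is the value of the bump at its centre; it is left unnormalized because it cancels in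
    [metric_connection_trace]. *)
Lemma bump_frame p : exists (Z : 'I_n -> vector_field M) (b : R),
  [/\ b != 0, forall i, smooth_field (Z i) & forall i, Z i p = b *: e i].
Proof.
pose a := chart_at p; have ap : dom a p := chart_at_dom p.
have aa : atlas a := chart_at_atlas p.
pose x0 := coord a p.
have : nbhs x0 (chart_image a).
  by apply: open_nbhs_nbhs; split; [exact: image_open|exact: coord_image].
case/nbhs_ballP => r' /= r'0 Hr'.
pose r := r' / 2; have r0 : 0 < r by rewrite divr_gt0.
have rr' : r < r' by rewrite /r ltr_pdivrMr // ltr_pMr // ltr1n.
pose K := [set x : 'rV[R]_n | `|x - x0| <= r].
have Kim : K `<=` chart_image a.
  move=> x Kx; apply: Hr'; rewrite -ball_normE /ball_ /= distrC.
  exact: le_lt_trans rr'.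
have cK : compact K.
  have -> : K = closed_ball_ (fun x => `|x|) x0 r.
    by apply/seteqP; split => x; rewrite /K /closed_ball_ /= distrC.
  apply: bounded_closed_compact; last exact: closed_closed_ball_.
  exists (`|x0| + r); split; first exact: num_real.
  move=> m hm x; rewrite /closed_ball_ /= => Hx.
  rewrite (le_trans _ (ltW hm)) // -[x](subrK x0) addrC.
  by rewrite (le_trans (ler_normD _ _)) // lerD2l distrC.
pose K' := param a @` K.
(* A compact set is closed because [M] is Hausdorff. This makes the extension by zero smooth across
   the edge of [dom a]. *)
have clK' : closed K'.
  apply: compact_closed; first exact: manifold_hausdorff.
  apply: continuous_compact cK.
  apply: (@continuous_subspaceW _ _ _ (chart_image a)) => //.
  exact: param_continuous.
have K'dom : K' `<=` dom a by move=> _ [x Kx <-]; have [] := chart_imageP (Kim _ Kx).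
pose Z i : vector_field M := fun q =>
  if q \in dom a then bump x0 r (coord a q) *: row i (jac a (chart_at q) q) else 0.
exists Z, (bump x0 r x0); split; first exact: bump_center.
- move=> i c ac j; apply: smooth_in_chart_local => q cq.
  have sac := atlas_smooth aa ac; have sca := atlas_smooth ac aa.
  (* The open sets [dom a] and the complement of [K'] cover [M]: on the first the field is a bump
     times a coordinate vector, on the second it vanishes. *)
  have [K'q|K'q] := pselect (K' q).
    pose G y := bump x0 r (transition c a y) * jac a c (param c y) i j.
    exists (dom a), G; split.
    + exact: dom_open.
    + exact: K'dom.
    + move=> q' cq' aq'.
      rewrite /G /Z mem_set // transitionE // coordK // -scalemxAl mxE.
      rewrite -row_mul -jac_comp ?mxE //; last exact: chart_at_dom.
      * exact: atlas_smooth (chart_at_atlas _).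
      * exact: atlas_smooth (chart_at_atlas _) _.
    + apply: (smooth_on_mul (@open_overlap _ _ _ c a)); last exact: smooth_on_jac.
      apply: (smooth_on_comp (@open_overlap _ _ _ c a) openT _ sca) => //.
      exact: smooth_on_bump openT.
  exists (~` K'), (fun=> 0); split.
  + exact: closed_openC.
  + exact: K'q.
  + move=> q' cq' K'q'; rewrite /Z; case: ifPn => [/set_mem aq'|_]; last first.
      by rewrite mul0mx mxE.
    suff -> : bump x0 r (coord a q') = 0 by rewrite scale0r mul0mx mxE.
    apply: contrapT => /eqP /(bump_support r0) Kq'; apply: K'q'.
    by exists (coord a q') => //; rewrite coordK.
  + exact: smooth_on_cst.
- by move=> i; rewrite /Z mem_set // -/a jac_id // rowE mulmx1.
Qed.

End ManifoldCalculus.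

(** * Derivations at a point *)

Section SmoothInChart.
Variables (R : realType) (n : nat) (M : manifold R n) (a : chart R n M).
Implicit Types (h k : M -> R).

Lemma smooth_in_chart_cst (c : R) : smooth_in_chart a (fun=> c).
Proof. exact: smooth_on_cst. Qed.

Lemma smooth_in_chartD h k : smooth_in_chart a h -> smooth_in_chart a k ->
  smooth_in_chart a (fun q => h q + k q).
Proof. exact: (smooth_on_add (@image_open _ _ _ a)). Qed.

Lemma smooth_in_chartM h k : smooth_in_chart a h -> smooth_in_chart a k ->
  smooth_in_chart a (fun q => h q * k q).
Proof. exact: (smooth_on_mul (@image_open _ _ _ a)). Qed.

Lemma smooth_in_chart_sum (I : Type) (r : seq I) (h : I -> M -> R) :
  (forall i, smooth_in_chart a (h i)) ->
  smooth_in_chart a (fun q => \sum_(i <- r) h i q).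
Proof. by move=> sh; apply: (smooth_on_sum _ (@image_open _ _ _ a)) => i _; exact: sh. Qed.

Lemma smooth_in_chart_prod (I : Type) (r : seq I) (h : I -> M -> R) :
  (forall i, smooth_in_chart a (h i)) ->
  smooth_in_chart a (fun q => \prod_(i <- r) h i q).
Proof. by move=> sh; apply: (smooth_on_prod _ (@image_open _ _ _ a)) => i _; exact: sh. Qed.

Lemma smooth_in_chart_expR h : smooth_in_chart a h ->
  smooth_in_chart a (fun q => expR (h q)).
Proof. exact: (smooth_on_expR (@image_open _ _ _ a)). Qed.

End SmoothInChart.

Section Derivations.
Variables (R : realType) (n : nat) (M : manifold R n) (p : M) (v : 'rV[R]_n).
Implicit Types (h k : M -> R).
Local Notation smooth_near := (smooth_in_chart (chart_at p)).
Local Notation delta h := (dfun h p v).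

Lemma is_derive_dfun h : smooth_near h ->
  is_derive (coord (chart_at p) p) v (h \o param (chart_at p)) (delta h).
Proof.
move=> sh; have d := smooth_in_chart_differentiable sh (chart_at_dom p).
by split; [exact: diff_derivable|rewrite (deriveE _ d)].
Qed.

Lemma dfun_eqP h d :
  is_derive (coord (chart_at p) p) v (h \o param (chart_at p)) d ->
  smooth_near h -> delta h = d.
Proof. by move=> [_ <-] sh; have [_ ->] := is_derive_dfun sh. Qed.

Lemma eq_dfun h k : (forall q, dom (chart_at p) q -> h q = k q) ->
  smooth_near h -> delta h = delta k.
Proof.
move=> hk sh; apply/esym; apply: dfun_eqP (eq_smooth_in_chart hk sh).
apply: near_eq_is_derive (is_derive_dfun sh).
have cp := chart_at_dom p.
apply: filterS (near_param cp (@dom_open _ _ _ (chart_at p)) cp) => y [cy _].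
exact: hk.
Qed.

Lemma dfun_cst (c : R) : delta (fun=> c) = 0.
Proof.
apply: dfun_eqP; first exact: is_derive_cst.
exact: smooth_in_chart_cst.
Qed.

Lemma dfunD h k : smooth_near h -> smooth_near k ->
  delta (fun q => h q + k q) = delta h + delta k.
Proof.
move=> sh sk; apply: (@dfun_eqP (fun q => h q + k q)); last exact: smooth_in_chartD.
exact: is_deriveD (is_derive_dfun sh) (is_derive_dfun sk).
Qed.

Lemma dfunM h k : smooth_near h -> smooth_near k ->
  delta (fun q => h q * k q) = delta h * k p + h p * delta k.
Proof.
move=> sh sk; apply: (@dfun_eqP (fun q => h q * k q)); last exact: smooth_in_chartM.
apply: is_derive_eq (is_deriveM (is_derive_dfun sh) (is_derive_dfun sk)) _.
rewrite /= coordK; last exact: chart_at_dom.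
by rewrite addrC; congr (_ + _); apply: mulrC.
Qed.

Lemma dfun_sum (I : Type) (r : seq I) (h : I -> M -> R) :
  (forall i, smooth_near (h i)) ->
  delta (fun q => \sum_(i <- r) h i q) = \sum_(i <- r) delta (h i).
Proof.
move=> sh; elim: r => [|i r IH].
  rewrite big_nil; apply: etrans _ (dfun_cst 0); congr (dfun _ _ _).
  by apply/funext => q; rewrite big_nil.
have -> : (fun q => \sum_(j <- i :: r) h j q) = (fun q => h i q + \sum_(j <- r) h j q).
  by apply/funext => q; rewrite big_cons.
rewrite (dfunD (sh i) (smooth_in_chart_sum r sh)) IH.
by rewrite big_cons.
Qed.

Lemma dfun_prod m (h : 'I_m -> M -> R) : (forall i, smooth_near (h i)) ->
  delta (fun q => \prod_i h i q) =
  \sum_i \prod_k (if k == i then delta (h k) else h k p).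
Proof.
elim: m h => [|m IH] h sh.
  rewrite big_ord0; apply: etrans _ (dfun_cst 1); congr (dfun _ _ _).
  by apply/funext => q; rewrite big_ord0.
rewrite (_ : (fun q => _) = (fun q => h ord0 q * \prod_i h (lift ord0 i) q)); last first.
  by apply/funext => q; rewrite big_ord_recl.
rewrite (dfunM (sh ord0) (smooth_in_chart_prod _ (fun i => sh (lift ord0 i)))).
rewrite IH // big_ord_recl; congr (_ + _).
  by rewrite big_ord_recl eqxx.
rewrite mulr_sumr; apply: eq_bigr => i _; rewrite big_ord_recl /=.
by congr (_ * _); apply: eq_bigr => k _; rewrite (inj_eq lift_inj).
Qed.

Lemma dfun_expR h : smooth_near h -> delta (fun q => expR (h q)) = delta h * expR (h p).
Proof.
move=> sh; apply: (@dfun_eqP (fun q => expR (h q))); last exact: smooth_in_chart_expR.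
have H := is_derive_comp (is_derive_dfun sh) (is_derive_expR _).
apply: is_derive_eq H _.
by rewrite /= (coordK (chart_at_dom p)) mulrC.
Qed.

Definition smooth_mx m l (A : M -> 'M[R]_(m, l)) : Prop :=
  forall i j, smooth_near (fun q => A q i j).

Definition dmx m l (A : M -> 'M[R]_(m, l)) : 'M[R]_(m, l) :=
  \matrix_(i, j) delta (fun q => A q i j).

Lemma smooth_mxM m l s (A : M -> 'M[R]_(m, l)) (B : M -> 'M[R]_(l, s)) :
  smooth_mx A -> smooth_mx B -> smooth_mx (fun q => A q *m B q).
Proof.
move=> sA sB i j.
have s0 : smooth_near (fun q => \sum_k A q i k * B q k j).
  by apply: smooth_in_chart_sum => k; exact: smooth_in_chartM.
by apply: eq_smooth_in_chart s0 => q _; rewrite mxE.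
Qed.

Lemma smooth_mxT m l (A : M -> 'M[R]_(m, l)) :
  smooth_mx A -> smooth_mx (fun q => (A q)^T).
Proof. by move=> sA i j; apply: eq_smooth_in_chart (sA j i) => q _; rewrite mxE. Qed.

Lemma dmxM m l s (A : M -> 'M[R]_(m, l)) (B : M -> 'M[R]_(l, s)) :
  smooth_mx A -> smooth_mx B ->
  dmx (fun q => A q *m B q) = dmx A *m B p + A p *m dmx B.
Proof.
move=> sA sB; apply/matrixP => i j; rewrite !mxE.
rewrite (_ : (fun q => _) = (fun q => \sum_k A q i k * B q k j)); last first.
  by apply/funext => q; rewrite mxE.
rewrite dfun_sum => [|k]; last exact: smooth_in_chartM.
by rewrite -big_split; apply: eq_bigr => k _; rewrite (dfunM (sA i k) (sB k j)) !mxE.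
Qed.

Lemma dmxT m l (A : M -> 'M[R]_(m, l)) : dmx (fun q => (A q)^T) = (dmx A)^T.
Proof.
apply/matrixP => i j; rewrite !mxE; congr (dfun _ _ _).
by apply/funext => q; rewrite mxE.
Qed.

(** Laplace expansion along the replaced row, whose cofactors are still those of [A]. *)
Lemma det_replace_row m (A B : 'M[R]_m) :
  \sum_i \det (\matrix_k (if k == i then row k B else row k A)) = \tr (B *m \adj A).
Proof.
apply: eq_bigr => i _; rewrite (expand_det_row _ i) mxE; apply: eq_bigr => j _.
rewrite !mxE eqxx mxE; congr (_ * _).
rewrite /cofactor; congr (_ * \det _); apply/matrixP => k l; rewrite !mxE.
by rewrite eq_sym (negPf (neq_lift _ _)) mxE.
Qed.

(** Jacobi's formula. In each term of the Leibniz expansion one factor is differentiated; exchanging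
    the sums collects determinants with one row differentiated. The adjugate keeps it valid where
    [A p] is singular. *)
Lemma dfun_det m (A : M -> 'M[R]_m) : smooth_mx A ->
  delta (fun q => \det (A q)) = \tr (dmx A *m \adj (A p)).
Proof.
move=> sA; rewrite -det_replace_row.
have sprod (s : {perm 'I_m}) : smooth_near (fun q => \prod_i A q i (s i)).
  by apply: smooth_in_chart_prod => i; exact: sA.
rewrite /determinant dfun_sum => [|s]; last first.
  by apply: smooth_in_chartM => //; exact: smooth_in_chart_cst.
rewrite exchange_big /=; apply: eq_bigr => s _.
rewrite (dfunM (@smooth_in_chart_cst _ _ _ _ _) (sprod s)).
rewrite dfun_cst mul0r add0r -mulr_sumr dfun_prod //; congr (_ * _).
apply: eq_bigr => i _; apply: eq_bigr => k _; rewrite !mxE.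
by case: ifP => _; rewrite !mxE.
Qed.

End Derivations.

(** * Metrics and gradients *)

Section Metric.
Variables (R : realType) (n : nat) (M : manifold R n) (g : bilinear_field M).
Hypothesis gP : pseudo_riemannian_metric g.
Implicit Types (a b c : chart R n M) (p q : M) (X Y Z : vector_field M) (h : M -> R).
Notation e i := (delta_mx 0 i : 'rV[R]_n).

Lemma scalar_sum (V : lmodType R) (f : V -> R) : scalar f ->
  forall (I : Type) (r : seq I) (c : I -> R) (w : I -> V),
  f (\sum_(i <- r) c i *: w i) = \sum_(i <- r) c i * f (w i).
Proof.
move=> lf I r c w; elim: r => [|i r IH]; last by rewrite !big_cons lf IH.
(* The empty sum requires [f 0 = 0], which follows from linearity with coefficient -1 at the zero
   vector. *)
rewrite !big_nil; have := lf (-1) 0 0.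
by rewrite scaler0 addr0 => ->; rewrite mulN1r addNr.
Qed.

Definition metric_mx p : 'M[R]_n := \matrix_(i, j) g p (e i) (e j).

(** Entries of [g] in the fixed chart [a], hence smooth in [p]; those of [metric_mx] refer to the
    varying [chart_at p] and serve only pointwise. *)
Definition gram a p : 'M[R]_n :=
  \matrix_(i, j) g p (coord_vector a i p) (coord_vector a j p).

Lemma metric_mxE p u v : g p u v = (u *m metric_mx p *m v^T) 0 0.
Proof.
have [lg sg _ _] := gP.
rewrite {1}[v]row_sum_delta (scalar_sum (lg p u)) mxE.
apply: eq_bigr => j _; rewrite [X in _ = _ * X]mxE mulrC; congr (_ * _).
rewrite sg {1}[u]row_sum_delta (scalar_sum (lg p (e j))) mxE.
by apply: eq_bigr => i _; rewrite /metric_mx mxE sg.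
Qed.

Lemma metric_mx_unit p : metric_mx p \in unitmx.
Proof.
have [_ _ ndg _] := gP.
rewrite -row_free_unit -kermx_eq0; apply/eqP/row_matrixP => i.
rewrite row0; apply: (ndg p) => v.
by rewrite metric_mxE -row_mul mulmx_ker row0 mul0mx mxE.
Qed.

Lemma gramE a p :
  gram a p = jac a (chart_at p) p *m metric_mx p *m (jac a (chart_at p) p)^T.
Proof.
apply/matrixP => i j; rewrite /gram mxE metric_mxE /coord_vector -row_mul mxE [RHS]mxE.
by apply: eq_bigr => k _; congr (_ * _); rewrite !mxE.
Qed.

Lemma jac_unit a b p : atlas a -> atlas b -> dom a p -> dom b p ->
  jac a b p \in unitmx.
Proof.
move=> aa ab ap bp; have [H _] := mulmx1_unit (jac_atlasK aa ab ap bp); exact: H.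
Qed.

Lemma gram_unit a p : atlas a -> dom a p -> gram a p \in unitmx.
Proof.
move=> aa ap; rewrite gramE !unitmx_mul metric_mx_unit unitmx_tr.
by rewrite jac_unit //; [exact: chart_at_atlas|exact: chart_at_dom].
Qed.

Lemma gram_chart_at p : gram (chart_at p) p = metric_mx p.
Proof. by rewrite gramE jac_id ?trmx1 ?mulmx1 ?mul1mx //; exact: chart_at_dom. Qed.

Lemma mulmx_change_basis m l (u : 'M[R]_(m, n)) (v : 'M[R]_(l, n)) (J J' G : 'M[R]_n) :
  J *m J' = 1%:M ->
  (u *m J) *m (J' *m G *m J'^T) *m (v *m J)^T = u *m G *m v^T.
Proof.
move=> K; rewrite trmx_mul !mulmxA -(mulmxA u J) K mulmx1.
by rewrite -(mulmxA _ J'^T) -trmx_mul K trmx1 mulmx1.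
Qed.

Lemma metric_gram a p u v : atlas a -> dom a p ->
  g p u v = (u *m jac (chart_at p) a p *m gram a p *m (v *m jac (chart_at p) a p)^T) 0 0.
Proof.
move=> aa ap.
have K := jac_atlasK (chart_at_atlas p) aa (chart_at_dom p) ap.
by rewrite gramE (mulmx_change_basis _ _ _ K) metric_mxE.
Qed.

Lemma smooth_gram a i j : atlas a -> smooth_in_chart a (fun p => gram a p i j).
Proof.
have [_ _ _ sg] := gP => aa; apply: eq_smooth_in_chart (sg a aa i j) => q _.
by rewrite /gram mxE.
Qed.

Lemma smooth_metric a X Y : atlas a -> smooth_field X -> smooth_field Y ->
  smooth_in_chart a (fun q => g q (X q) (Y q)).
Proof.
move=> aa sX sY.
have s : smooth_in_chart a (fun q => \sum_j
    (\sum_i components a X q 0 i * gram a q i j) * components a Y q 0 j).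
  apply: smooth_in_chart_sum => j; apply: smooth_in_chartM; last exact: sY.
  apply: smooth_in_chart_sum => i; apply: smooth_in_chartM; first exact: sX.
  exact: smooth_gram.
apply: eq_smooth_in_chart s => q aq; rewrite (metric_gram _ _ aa aq) mxE.
by apply: eq_bigr => j _; congr (_ * _); rewrite [RHS]mxE.
Qed.

Lemma dfun_row p h v : dfun h p v = (v *m (\row_j dfun h p (e j))^T) 0 0.
Proof.
rewrite {1}/dfun {1}[v]row_sum_delta linear_sum mxE.
by apply: eq_bigr => j _; rewrite linearZ !mxE.
Qed.

Lemma gradientE p h v : g p (gradient g h p) v = dfun h p v.
Proof.
move: v; apply: (@getPex _ [set u | forall v, g p u v = dfun h p v]).
(* [get] satisfies the defining property as soon as the set is inhabited. The witness solves
   [u *m metric_mx p = df], which nondegeneracy allows. *)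
exists ((\row_j dfun h p (e j)) *m invmx (metric_mx p)) => v /=.
rewrite metric_mxE mulmxKV ?metric_mx_unit // dfun_row.
by rewrite -[LHS]trace_mx11 -[RHS]trace_mx11 -mxtrace_tr trmx_mul trmxK.
Qed.

Lemma gradient_components a h p : atlas a -> dom a p -> smooth_in_chart a h ->
  components a (gradient g h) p = partial_row a h p *m invmx (gram a p).
Proof.
move=> aa ap sh.
have ca := chart_at_atlas p; have cp := chart_at_dom p.
suff E : components a (gradient g h) p *m gram a p = partial_row a h p.
  by rewrite -E mulmxK // gram_unit.
apply/rowP => j.
have [v Ev] : exists v : 'rV[R]_n, v *m jac (chart_at p) a p = e j.
  exists (e j *m jac a (chart_at p) p); apply: etrans (esym (mulmxA _ _ _)) _.
  by rewrite jac_atlasK ?mulmx1.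
have := gradientE p h v.
rewrite (metric_gram _ _ aa ap) (dfunE _ aa ap); last exact: smooth_in_chart_differentiable.
rewrite Ev trmx_delta -colE mxE => ->.
rewrite (bigD1 j) //= big1 => [|k kj]; first by rewrite mxE !eqxx mul1r addr0.
by rewrite mxE (negPf kj) andbF mul0r.
Qed.

Lemma smooth_gradient h : smooth_fun h -> smooth_field (gradient g h).
Proof.
move=> sh a aa j.
have oa := @image_open _ _ _ a.
have s : smooth_in_chart a (fun q => \sum_i partial_row a h q 0 i * (invmx (gram a q)) i j).
  apply: smooth_in_chart_sum => i; apply: smooth_in_chartM; first exact: smooth_partial (sh a aa).
  apply: (@smooth_on_invmx _ _ _ _ (gram a \o param a) oa) => [k l|x /chart_imageP[ax _]].
    exact: smooth_gram.
  exact: gram_unit.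
apply: eq_smooth_in_chart s => q aq.
by rewrite -/(components _ _ _) (gradient_components aa aq (sh a aa)) mxE.
Qed.

(** The terms added to [nabla] are linear over functions in both arguments, so the derivative term
    of the Leibniz rule comes from [nabla] alone. *)
Lemma affine_connection_nabla_df (nabla : field_operator M) (f : M -> R) :
  affine_connection nabla -> smooth_fun f ->
  affine_connection (nabla_df g nabla f).
Proof.
move=> [sn nl nr nL] sf.
have [lg sg _ _] := gP.
have lg' p (u v w : 'rV[R]_n) (c : R) : g p (c *: v + w) u = c * g p v u + g p w u.
  by rewrite !(sg p _ u) lg.
have ld p (c : R) (v w : 'rV[R]_n) : dfun f p (c *: v + w) = c * dfun f p v + dfun f p w.
  exact: linearP.
have gZ p (u v : 'rV[R]_n) (c : R) : g p u (c *: v) = c * g p u v.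
  by rewrite !metric_mxE linearZ /= -scalemxAr mxE.
have dZ p (c : R) (v : 'rV[R]_n) : dfun f p (c *: v) = c * dfun f p v by rewrite /dfun linearZ.
split.
- move=> X Y sX sY a aa j.
  have s : smooth_in_chart a (fun q => components a (nabla X Y) q 0 j
      + deriv_along X f q * components a Y q 0 j
      + deriv_along Y f q * components a X q 0 j
      + g q (X q) (Y q) * components a (gradient g f) q 0 j).
    apply: smooth_in_chartD; first apply: smooth_in_chartD; first apply: smooth_in_chartD.
    + exact: sn.
    + by apply: smooth_in_chartM; [exact: smooth_deriv_along (sf a aa) sX|exact: sY].
    + by apply: smooth_in_chartM; [exact: smooth_deriv_along (sf a aa) sY|exact: sX].
    + apply: smooth_in_chartM; first exact: smooth_metric.
      exact: smooth_gradient sf a aa j.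
  apply: eq_smooth_in_chart s => q aq.
  by rewrite /nabla_df !mulmxDl -!scalemxAl !mxE.
- move=> h X Y Z sh sX sY sZ p.
  rewrite /nabla_df (nl _ _ _ _ sh sX sY sZ) ld lg'.
  move: (nabla X Z p) (nabla Y Z p) (dfun f p (X p)) (dfun f p (Y p)) => NX NY dX dY.
  move: (dfun f p (Z p)) (g p (X p) (Z p)) (g p (Y p) (Z p)) => dZ' gXZ gYZ.
  move: (gradient g f p) (h p) (X p) (Y p) (Z p) => G t x y z.
  by apply/rowP => j; rewrite !mxE; ring.
- move=> c X Y Z sX sY sZ p.
  rewrite /nabla_df (nr _ _ _ _ sX sY sZ) ld lg.
  move: (nabla X Y p) (nabla X Z p) (dfun f p (X p)) (dfun f p (Y p)) => NY NZ dX dY.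
  move: (dfun f p (Z p)) (g p (X p) (Y p)) (g p (X p) (Z p)) => dZ' gXY gXZ.
  move: (gradient g f p) (X p) (Y p) (Z p) => G x y z.
  by apply/rowP => j; rewrite !mxE; ring.
- move=> h X Y sh sX sY p.
  rewrite /nabla_df (nL _ _ _ sh sX sY) dZ gZ.
  move: (deriv_along X h p) (nabla X Y p) (dfun f p (X p)) (dfun f p (Y p)) => d N dX dY.
  move: (g p (X p) (Y p)) (gradient g f p) (h p) (X p) (Y p) => gXY G t x y.
  by apply/rowP => j; rewrite !mxE; ring.
Qed.

End Metric.

(** * The volume form *)

Section TraceAlgebra.
Variables (R : realType) (n : nat).
Implicit Types (V A S : 'M[R]_n).

Lemma mxtraceB V A : \tr (V - A) = \tr V - \tr A.
Proof. exact: raddfB. Qed.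

Lemma trace_mul_adj V A : \tr (V *m A *m \adj V) = \det V * \tr A.
Proof.
by rewrite mxtrace_mulC mulmxA mul_adj_mx mul_scalar_mx mxtraceZ.
Qed.

Lemma trace_adj_invmx A S : S \in unitmx ->
  \tr (A *m \adj S) = \det S * \tr (A *m invmx S).
Proof.
move=> uS; rewrite /invmx uS -scalemxAr mxtraceZ mulrA mulfV ?mul1r //.
by rewrite -unitfE -unitmxE.
Qed.

(** [P] and [Q] stand for [V' - N] of the given fields and of the test frame. The second equation
    times [S^-1] has trace giving [2 tr Q = - b tr (S' S^-1)]. The first times [S^-1 adj V] has
    trace [b tr (P adj V) + b det V tr (S' S^-1) + det V tr Q = 0], from which [tr Q] is
    eliminated. *)
Lemma metric_connection_trace V P Q S S' (b : R) :
  b != 0 -> S \in unitmx ->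
  P *m S *m (b%:M)^T + V *m S' *m (b%:M)^T + V *m S *m Q^T = 0 ->
  Q *m S *m (b%:M)^T + b%:M *m S' *m (b%:M)^T + b%:M *m S *m Q^T = 0 ->
  \tr (P *m \adj V) *+ 2 = - (\det V * \tr (S' *m invmx S)).
Proof.
move=> b0 uS; rewrite !tr_scalar_mx !mul_mx_scalar !mul_scalar_mx => HV HW.
have HQ : \tr Q *+ 2 = - (b * \tr (S' *m invmx S)).
  have := congr1 (fun B => \tr (B *m invmx S)) HW.
  rewrite !mulmxDl mul0mx mxtrace0 !mxtraceD -!scalemxAl mulmxK //.
  rewrite !mxtraceZ -(mulmxA S) (mxtrace_mulC S) -mulmxA mulVmx //.
  rewrite mulmx1 mxtrace_tr => H; apply: (mulfI b0).
  by apply/eqP; rewrite -subr_eq0 -H; apply/eqP; rewrite mulr2n; ring.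
have := congr1 (fun B => \tr (B *m invmx S *m \adj V)) HV.
rewrite !mulmxDl !mul0mx mxtrace0 !mxtraceD -!scalemxAl mulmxK // !mxtraceZ.
rewrite -(mulmxA V S') trace_mul_adj -(mulmxA V S) -(mulmxA V) trace_mul_adj.
rewrite -(mulmxA S) (mxtrace_mulC S) -mulmxA mulVmx // mulmx1 mxtrace_tr => H.
apply: (mulfI b0); move: HQ H.
move: (\tr Q) (\tr (P *m _)) (\tr (S' *m _)) (\det V) => t u s d HQ H.
rewrite mulrnAr.
have -> : b * u *+ 2 = (b * u + b * (d * s) + d * t) *+ 2 - 2 * b * (d * s) - d * (t *+ 2).
  by rewrite !mulr2n; ring.
by rewrite H HQ; rewrite mul0rn; ring.
Qed.

End TraceAlgebra.

(** * The weighted volume form of an oriented atlas *)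

Section Volume.
Variables (R : realType) (n : nat) (M : manifold R n) (g : bilinear_field M).
Variables (B : set (chart R n M)) (oriented_chart : M -> chart R n M) (f : M -> R).
Hypothesis gP : pseudo_riemannian_metric g.
Hypothesis B_smooth : forall a b, atlas a -> B b ->
  smooth_transition a b /\ smooth_transition b a.
Hypothesis B_oriented : forall b c, B b -> B c -> forall p : M, dom b p -> dom c p ->
  0 < \det (jac b c p).
Hypothesis oriented_chartB : forall p, B (oriented_chart p).
Hypothesis oriented_chart_dom : forall p, dom (oriented_chart p) p.
Hypothesis sf : smooth_fun f.
Implicit Types (a b c : chart R n M) (p q : M).
Notation e i := (delta_mx 0 i : 'rV[R]_n).

(** The coefficient of the form in [chart_at p]. Charts of the atlas may reverse the orientation
    given by [B]; the sign records whether [chart_at p] does. *)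
Definition density p : R :=
  Num.sg (\det (jac (chart_at p) (oriented_chart p) p)) *
  (Num.sqrt `|\det (metric_mx g p)| * expR (n.+2%:R * f p)).

Definition volume : form_field M := fun p v => density p * \det (\matrix_i v i).

Definition coefficient a p : R := volume p (fun i => coord_vector a i p).

Lemma coefficient_jac a p : coefficient a p = density p * \det (jac a (chart_at p) p).
Proof.
rewrite /coefficient /volume; congr (_ * \det _).
by apply/row_matrixP => i; rewrite rowK.
Qed.

(** Charts of [B] around [p] differ by a positive Jacobian, so any [b] may replace the selected
    [oriented_chart p]. A single [b] then works on a whole neighbourhood, although the selection may
    jump. *)
Lemma orientation_sign a b p : atlas a -> B b -> dom a p -> dom b p ->
  Num.sg (\det (jac (chart_at p) (oriented_chart p) p)) *
  Num.sg (\det (jac a (chart_at p) p)) = Num.sg (\det (jac a b p)).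
Proof.
move=> aa Bb ap bp.
have ca := chart_at_atlas p; have cp := chart_at_dom p.
have Bo := oriented_chartB p; have op := oriented_chart_dom p.
have [scb sbc] := B_smooth ca Bb; have [sco soc] := B_smooth ca Bo.
have sac := atlas_smooth aa ca.
have J1 := jac_comp sac scb ap cp bp.
have J2 := jac_comp sbc sco bp cp op.
have K := jacK scb sbc cp bp.
have pos := B_oriented Bb Bo bp op.
move: K J1 J2 pos.
move: (jac (chart_at p) b p) (jac b (chart_at p) p) (jac a (chart_at p) p).
move: (jac a b p) (jac b (oriented_chart p) p) (jac (chart_at p) (oriented_chart p) p).
move=> Jab Jbo Jco Jcb Jbc Jac K -> J2 pos.
have -> : Jco = Jcb *m Jbo by rewrite J2 mulmxA K mul1mx.
by rewrite !det_mulmx !sgrM (gtr0_sg pos) mulr1 mulrC.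
Qed.

(** Under a change of basis [J] the Gram determinant is multiplied by [(det J)^2], hence its root by
    [|det J|]; the missing sign of [det J] turns the sign relative to [oriented_chart p] into that
    of [jac a b p]. *)
Lemma coefficientE a b p : atlas a -> B b -> dom a p -> dom b p ->
  coefficient a p = Num.sg (\det (jac a b p)) *
    (Num.sqrt `|\det (gram g a p)| * expR (n.+2%:R * f p)).
Proof.
move=> aa Bb ap bp.
have S := orientation_sign aa Bb ap bp.
rewrite coefficient_jac /density (gramE gP).
move: S; move: (jac a (chart_at p) p) (jac (chart_at p) (oriented_chart p) p) => J Jo.
move: (jac a b p) (expR _) (metric_mx g p) => Jb x m <-.
have -> : Num.sqrt `|\det (J *m m *m J^T)| = `|\det J| * Num.sqrt `|\det m|.
  rewrite !det_mulmx det_tr !normrM mulrAC -expr2 sqrtrM ?sqr_ge0 //.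
  by rewrite sqrtr_sqr normr_id.
by rewrite {1}[\det J]numEsg; ring.
Qed.

Lemma det_jac_neq0 a b p : atlas a -> B b -> dom a p -> dom b p ->
  \det (jac a b p) != 0.
Proof.
move=> aa Bb ap bp; have [sab sba] := B_smooth aa Bb.
have [H _] := mulmx1_unit (jacK sab sba ap bp).
by rewrite -unitfE -unitmxE.
Qed.

Lemma det_gram_neq0 a p : atlas a -> dom a p -> \det (gram g a p) != 0.
Proof. by move=> aa ap; rewrite -unitfE -unitmxE (gram_unit gP). Qed.

Lemma smooth_weight a : atlas a -> smooth_in_chart a (fun p => expR (n.+2%:R * f p)).
Proof.
move=> aa; apply: smooth_in_chart_expR; apply: smooth_in_chartM; last exact: sf.
exact: smooth_in_chart_cst.
Qed.

Lemma smooth_det_gram a : atlas a -> smooth_in_chart a (fun p => \det (gram g a p)).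
Proof.
move=> aa; apply: (smooth_on_det (A := gram g a \o param a) (@image_open _ _ _ a)) => i j.
exact: (smooth_gram gP).
Qed.

(* The sign of D is written sqrt|D| * sqrt|D| / D, which is smooth where D != 0. *)
Lemma smooth_coefficient a : atlas a -> smooth_in_chart a (coefficient a).
Proof.
move=> aa; apply: smooth_in_chart_local => q aq.
pose b := oriented_chart q.
have Bb : B b := oriented_chartB q; have bq : dom b q := oriented_chart_dom q.
have [sab sba] := B_smooth aa Bb.
pose D x := \det (jac a b (param a x)).
pose W x := Num.sqrt `|\det (gram g a (param a x))| * expR (n.+2%:R * f (param a x)).
have oab := @open_overlap _ _ _ a b.
have sub : overlap a b `<=` chart_image a by move=> x [q' [aq' _] <-]; exact: coord_image.
have sD : smooth_on (overlap a b) D.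
  apply: (smooth_on_det (A := fun x => jac a b (param a x)) oab) => i j.
  exact: smooth_on_jac_source.
have D0 x : overlap a b x -> D x != 0.
  by move=> [q' [aq' bq'] <-]; rewrite /D coordK //; exact: det_jac_neq0.
have sW : smooth_on (overlap a b) W.
  apply: (smooth_on_sub sub); apply: (smooth_on_mul (@image_open _ _ _ a)).
    apply: (smooth_on_sqrt_norm (@image_open _ _ _ a)); last exact: smooth_det_gram.
    by move=> x /chart_imageP[ax _]; exact: det_gram_neq0.
  exact: smooth_weight.
have sS := smooth_on_sqrt_norm oab D0 sD.
exists (dom b), (fun x => Num.sqrt `|D x| * Num.sqrt `|D x| * (D x)^-1 * W x); split.
- exact: dom_open.
- exact: bq.
- move=> q' aq' bq'; rewrite (coefficientE aa Bb aq' bq') /W /D coordK //.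
  have := det_jac_neq0 aa Bb aq' bq'; move: (\det (jac a b q')) => d d0.
  congr (_ * _); rewrite -expr2 sqr_sqrtr // normrEsg.
  by rewrite -mulrA mulfV // mulr1.
- apply: (smooth_on_mul oab _ sW); apply: (smooth_on_mul oab (smooth_on_mul oab sS sS)).
  exact: (smooth_on_inv oab D0 sD).
Qed.

Lemma coefficient_neq0 a p : atlas a -> dom a p -> coefficient a p != 0.
Proof.
move=> aa ap; have Bo := oriented_chartB p; have op := oriented_chart_dom p.
rewrite (coefficientE aa Bo ap op) !mulf_neq0 ?sgr_eq0 ?det_jac_neq0 //.
- by rewrite sqrtr_eq0 -ltNge normr_gt0 det_gram_neq0.
- by rewrite gt_eqF // expR_gt0.
Qed.

(** The first squaring removes the sign and the root, the second the absolute value. What remains is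
    polynomial in smooth functions, so the coefficient can be differentiated by the product rule
    only. *)
Lemma coefficient_expr4 a p : atlas a -> dom a p ->
  coefficient a p * coefficient a p * (coefficient a p * coefficient a p) =
  expR (n.+2%:R * f p) * expR (n.+2%:R * f p) *
  (expR (n.+2%:R * f p) * expR (n.+2%:R * f p)) *
  (\det (gram g a p) * \det (gram g a p)).
Proof.
move=> aa ap; have Bo := oriented_chartB p; have op := oriented_chart_dom p.
rewrite (coefficientE aa Bo ap op).
have := det_jac_neq0 aa Bo ap op.
move: (\det (jac a _ p)) (expR _) (\det (gram g a p)) => d x s d0.
have sg2 : Num.sg d * Num.sg d = 1.
  by rewrite -expr2 sqr_sg d0.
have ss : Num.sqrt `|s| * Num.sqrt `|s| = `|s| by rewrite -expr2 sqr_sqrtr.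
have nn : `|s| * `|s| = s * s by rewrite -normrM ger0_norm // -expr2 sqr_ge0.
transitivity ((Num.sg d * Num.sg d) * (Num.sg d * Num.sg d) * (x * x * (x * x)) *
  ((Num.sqrt `|s| * Num.sqrt `|s|) * (Num.sqrt `|s| * Num.sqrt `|s|))); first by ring.
by rewrite sg2 ss nn !mul1r.
Qed.

Lemma volume_form_volume : volume_form volume.
Proof.
split.
- move=> p; split=> [v i c u u'|v i j ij vij].
    rewrite /volume (@determinant_multilinear _ _ _ (\matrix_k replace v i u k)
      (\matrix_k replace v i u' k) i c 1).
    + by rewrite mul1r mulrDr mulrCA.
    + by rewrite !rowK /replace eqxx scale1r.
    + apply/matrixP => k l; rewrite !mxE /replace.
      by rewrite eq_sym (negPf (neq_lift _ _)).
    + apply/matrixP => k l; rewrite !mxE /replace.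
      by rewrite eq_sym (negPf (neq_lift _ _)).
  by rewrite /volume (determinant_alternate ij) ?mulr0 // => k; rewrite !mxE vij.
(* The coordinate frame of [chart_at p], written so that its value under [volume] is a
   [coefficient]. *)
- move=> p; exists (fun i => row i (jac (chart_at p) (chart_at p) p)).
  apply: (coefficient_neq0 (chart_at_atlas p) (chart_at_dom p)).
- by move=> a aa; exact: smooth_coefficient.
Qed.

Definition field_mx a (Y : 'I_n -> vector_field M) p : 'M[R]_n :=
  \matrix_i components a (Y i) p.

Lemma volume_fields a (Y : 'I_n -> vector_field M) p : atlas a -> dom a p ->
  volume p (fun i => Y i p) = coefficient a p * \det (field_mx a Y p).
Proof.
move=> aa ap; rewrite coefficient_jac /volume -mulrA [X in _ = _ * X]mulrC -det_mulmx.
congr (_ * \det _); apply/row_matrixP => i.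
by rewrite rowK row_mul rowK (componentsK _ aa ap).
Qed.

Lemma smooth_field_mx a (Y : 'I_n -> vector_field M) i j :
  atlas a -> (forall i, smooth_field (Y i)) ->
  smooth_in_chart a (fun p => field_mx a Y p i j).
Proof.
by move=> aa sY; apply: eq_smooth_in_chart (sY i a aa j) => q _; rewrite [RHS]mxE.
Qed.

(** * First-order identities at a fixed point *)

Section AtPoint.
Variables (p : M) (v : 'rV[R]_n).
Let a := chart_at p.
Let aa : atlas a := chart_at_atlas p.
Let ap : dom a p := chart_at_dom p.
Let S' := dmx p v (gram g a).

Lemma dfun_coefficient : dfun (coefficient a) p v *+ 2 =
  coefficient a p * (n.+2%:R * dfun f p v *+ 2 + \tr (S' *m invmx (gram g a p))).
Proof.
have sc := smooth_coefficient aa; have sE := smooth_weight aa.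
have sD := smooth_det_gram aa.
have sc2 := smooth_in_chartM sc sc; have sE2 := smooth_in_chartM sE sE.
have sD2 := smooth_in_chartM sD sD.
have sE4 := smooth_in_chartM sE2 sE2.
have H := @eq_dfun _ _ _ p v _ _ (fun q aq => coefficient_expr4 aa aq)
  (smooth_in_chartM sc2 sc2).
rewrite (dfunM _ sc2 sc2) (dfunM _ sc sc) (dfunM _ sE4 sD2) (dfunM _ sE2 sE2) in H.
rewrite (dfunM _ sE sE) (dfunM _ sD sD) in H.
have sf' := sf aa.
have snf := smooth_in_chartM (@smooth_in_chart_cst _ _ _ a n.+2%:R) sf'.
rewrite (dfun_expR _ snf) (dfunM _ (@smooth_in_chart_cst _ _ _ a _) sf') dfun_cst in H.
have dD : dfun (fun q => \det (gram g a q)) p v =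
    \det (gram g a p) * \tr (S' *m invmx (gram g a p)).
  rewrite dfun_det => [|i j]; last exact: (smooth_gram gP).
  exact: trace_adj_invmx (gram_unit gP aa ap).
rewrite dD in H; have c4 := coefficient_expr4 aa ap.
have c0 := coefficient_neq0 aa ap.
move: H c4 c0; move: (\tr _) (coefficient a p) (dfun (coefficient a) p v) => t c dc.
move: (expR _) (\det _) (dfun f p v) => x d df H c4 c0.
(* The differentiated identity has left side [4 c^3 dc]; cancelling [2 c^3] leaves the doubled
   derivative. *)
have c30 : 2 * (c * c * c) != 0 by rewrite !mulf_neq0 // pnatr_eq0.
apply: (mulfI c30).
transitivity ((dc * c + c * dc) * (c * c) + c * c * (dc * c + c * dc)).
  by rewrite mulr2n; ring.
rewrite H.
transitivity (c * c * (c * c) * (n.+2%:R * df *+ 2 + t) * 2).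
  by rewrite c4 mulr2n; ring.
by rewrite mulr2n; ring.
Qed.

Variable nabla : field_operator M.
Hypothesis metric_nabla : metric_compatible g nabla.
Variable X : vector_field M.
Hypothesis sX : smooth_field X.
Hypothesis Xp : X p = v.

Let N (Y : 'I_n -> vector_field M) : 'M[R]_n := \matrix_i nabla X (Y i) p.
Let V' (Y : 'I_n -> vector_field M) : 'M[R]_n := dmx p v (field_mx a Y).

(** The matrix of the functions [g (Y_i, Z_j)] is differentiated twice: by the product rule in the
    chart, and entry by entry by metric compatibility. The equation is the difference of the two
    results. *)
Lemma metric_compatible_mx (Y Z : 'I_n -> vector_field M) :
  (forall i, smooth_field (Y i)) -> (forall i, smooth_field (Z i)) ->
  (V' Y - N Y) *m gram g a p *m (field_mx a Z p)^T
  + field_mx a Y p *m S' *m (field_mx a Z p)^T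
  + field_mx a Y p *m gram g a p *m (V' Z - N Z)^T = 0.
Proof.
move=> sY sZ.
have sVY : smooth_mx p (field_mx a Y) by move=> i j; exact: smooth_field_mx.
have sVZ : smooth_mx p (field_mx a Z) by move=> i j; exact: smooth_field_mx.
have sS : smooth_mx p (gram g a) by move=> i j; exact: (smooth_gram gP).
have sYS := smooth_mxM sVY sS.
have := dmxM v sYS (smooth_mxT sVZ).
rewrite (dmxM v sVY sS) dmxT => H.
have gE (i j : 'I_n) q : dom a q ->
    (field_mx a Y q *m gram g a q *m (field_mx a Z q)^T) i j = g q (Y i q) (Z j q).
  move=> aq; rewrite (metric_gram gP _ _ aa aq) mxE [RHS]mxE.
  apply: eq_bigr => k _; congr (_ * _); last by rewrite !mxE.
  by rewrite mxE [RHS]mxE; apply: eq_bigr => l _; rewrite mxE.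
have dE : dmx p v (fun q => field_mx a Y q *m gram g a q *m (field_mx a Z q)^T) =
    N Y *m gram g a p *m (field_mx a Z p)^T + field_mx a Y p *m gram g a p *m (N Z)^T.
  (* At [p] the chart is [chart_at p] itself, so the values [nabla X (Y i) p] pair through the Gram
     matrix without a Jacobian. *)
  have gN (U W : 'I_n -> 'rV[R]_n) i j :
      ((\matrix_i U i) *m gram g a p *m (\matrix_i W i)^T) i j = g p (U i) (W j).
    rewrite (metric_mxE gP) /a (gram_chart_at gP) [LHS]mxE [RHS]mxE.
    apply: eq_bigr => k _; congr (_ * _); last by rewrite !mxE.
    by rewrite mxE [RHS]mxE; apply: eq_bigr => l _; rewrite mxE.
  have fE (T : 'I_n -> vector_field M) : field_mx a T p = \matrix_i T i p.
    by apply/row_matrixP => i; rewrite !rowK components_chart_at.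
  apply/matrixP => i j; rewrite mxE !fE mxE !gN -(metric_nabla sX (sY i) (sZ j)).
  rewrite /deriv_along Xp; apply: eq_dfun; first by move=> q; exact: gE.
  exact: (smooth_mxM sYS (smooth_mxT sVZ)).
rewrite dE in H; move: H; rewrite -/(V' Y) -/(V' Z) -/S'.
move: (V' Y) (V' Z) (N Y) (N Z) (field_mx a Y p) (field_mx a Z p) => P Q NY NZ VY VZ.
move: (gram g a p) (S') => S T.
have -> : (Q - NZ)^T = Q^T - NZ^T by apply/matrixP => i j; rewrite !mxE.
rewrite !mulmxBl mulmxBr mulmxDl.
move: (VY *m S *m NZ^T) (NY *m _ *m _) (P *m _ *m _) (_ *m T *m _) (_ *m Q^T).
move=> A1 A2 A3 A4 A5 H; rewrite (_ : _ + _ = (A3 + A4 + A5) - (A2 + A1)).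
  by rewrite H subrr.
by apply/matrixP => i j; rewrite !mxE; ring.
Qed.

Lemma trace_nabla (Y : 'I_n -> vector_field M) : (forall i, smooth_field (Y i)) ->
  \tr ((V' Y - N Y) *m \adj (field_mx a Y p)) *+ 2 =
  - (\det (field_mx a Y p) * \tr (S' *m invmx (gram g a p))).
Proof.
move=> sY; have [Z [b [b0 sZ Zp]]] := bump_frame p.
have Zb : field_mx a Z p = b%:M.
  apply/row_matrixP => i; rewrite rowK components_chart_at Zp.
  by rewrite rowE mul_mx_scalar.
have HV := metric_compatible_mx sY sZ; have HW := metric_compatible_mx sZ sZ.
rewrite Zb in HV HW.
exact: metric_connection_trace b0 (gram_unit gP aa ap) HV HW.
Qed.

(** Right multiplication of [V] by [A] contributes [det V * tr A]. The identity term gives [n] times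
    [df(X)], and each of the two rank-one terms gives [df(X)] once more. *)
Lemma trace_nabla_df (Y : 'I_n -> vector_field M) :
  \tr ((\matrix_i nabla_df g nabla f X (Y i) p) *m \adj (field_mx a Y p)) =
  \tr (N Y *m \adj (field_mx a Y p)) + n.+2%:R * dfun f p v * \det (field_mx a Y p).
Proof.
have fE : field_mx a Y p = \matrix_i Y i p.
  by apply/row_matrixP => i; rewrite !rowK components_chart_at.
pose D := \row_j dfun f p (e j); pose G := gradient g f p.
have outer m (A : 'M[R]_(m, 1)) (x : 'rV[R]_n) i j : (A *m x) i j = A i 0 * x 0 j.
  by rewrite mxE big_ord1.
(* Acting on rows, [Y |-> df(Y) X] is right multiplication by [D^T *m v], and [Y |-> g(X,Y) grad f]
   by [metric_mx g p *m v^T *m G]. *)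
have -> : \matrix_i nabla_df g nabla f X (Y i) p = N Y + dfun f p v *: field_mx a Y p
    + field_mx a Y p *m (D^T *m v) *m 1%:M
    + field_mx a Y p *m (metric_mx g p *m v^T *m G) *m 1%:M.
  rewrite fE !mulmx1; apply/row_matrixP => i; rewrite rowK !linearD linearZ /= !rowK.
  rewrite !row_mul !rowK /nabla_df Xp; congr (_ + _ + _ + _).
    by apply/rowP => j; rewrite mulmxA outer [LHS]mxE (dfun_row _ f).
  apply/rowP => j; rewrite !mulmxA outer [LHS]mxE; congr (_ * _).
  by have [_ sg _ _] := gP; rewrite sg (metric_mxE gP).
have tD : \tr (D^T *m v) = dfun f p v.
  by rewrite mxtrace_mulC trace_mx11 [RHS]dfun_row.
have tG : \tr (metric_mx g p *m v^T *m G) = dfun f p v.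
  by rewrite mxtrace_mulC trace_mx11 mulmxA -(metric_mxE gP) (gradientE gP).
rewrite !mulmxDl !mxtraceD !mulmx1 !trace_mul_adj tD tG -scalemxAl mxtraceZ.
rewrite mul_mx_adj mxtrace_scalar -[n.+2]addn2 natrD -mulr_natr; ring.
Qed.

Lemma parallel_at (Y : 'I_n -> vector_field M) : (forall i, smooth_field (Y i)) ->
  dfun (fun q => volume q (fun i => Y i q)) p v =
  \sum_i volume p (replace (fun j => Y j p) i (nabla_df g nabla f X (Y i) p)).
Proof.
move=> sY.
have fE : field_mx a Y p = \matrix_i Y i p.
  by apply/row_matrixP => i; rewrite !rowK components_chart_at.
have cE : coefficient a p = density p.
  by rewrite coefficient_jac jac_id // det1 mulr1.
have sV : smooth_mx p (field_mx a Y) by move=> i j; exact: smooth_field_mx.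
have sc := smooth_coefficient aa.
have sdet : smooth_in_chart a (fun q => \det (field_mx a Y q)).
  by apply: (smooth_on_det (A := field_mx a Y \o param a) (@image_open _ _ _ a)) => i j;
    exact: sV.
have -> : dfun (fun q => volume q (fun i => Y i q)) p v =
    dfun (fun q => coefficient a q * \det (field_mx a Y q)) p v.
  by apply/esym; apply: eq_dfun (smooth_in_chartM sc sdet) => q aq;
    rewrite (volume_fields Y aa aq).
rewrite (dfunM _ sc sdet) (dfun_det _ sV) -/(V' Y).
have -> : \sum_i volume p (replace (fun j => Y j p) i (nabla_df g nabla f X (Y i) p)) =
    coefficient a p * \tr ((\matrix_i nabla_df g nabla f X (Y i) p) *m \adj (field_mx a Y p)).
  rewrite -det_replace_row mulr_sumr cE; apply: eq_bigr => i _.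
  congr (_ * \det _); apply/row_matrixP => k; rewrite !rowK /replace.
  by case: eqP => [->|_] //; rewrite components_chart_at.
rewrite trace_nabla_df.
have := trace_nabla sY; have := dfun_coefficient; rewrite mulmxBl mxtraceB.
move: (\tr (V' Y *m _)) (\tr (N Y *m _)) (\tr (S' *m _)) (\det _) => t u s d.
move: (coefficient a p) (dfun (coefficient a) p v) (dfun f p v) => c dc df H1 H2.
(* [H1] and [H2] are doubled because the square root halves the logarithmic derivative of [det S];
   the trace of [S' S^-1] occurs in them with opposite signs and cancels. *)
have two : (2 : R) != 0 by rewrite pnatr_eq0.
apply: (mulfI two).
transitivity (dc *+ 2 * d + c * ((t - u) *+ 2) + 2 * (c * u)); first by rewrite !mulr2n; ring.
by rewrite H1 H2 !mulr2n; ring.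
Qed.

End AtPoint.

End Volume.

Theorem corollary3p5 (R : realType) (n : nat) (M : manifold R n)
    (g : bilinear_field M) (nabla : field_operator M) (f : M -> R) :
  orientable M ->
  pseudo_riemannian_metric g ->
  levi_civita g nabla ->
  smooth_fun f ->
  equiaffine (nabla_df g nabla f).
Proof.
move=> [B [Bcover Bsmooth Bor]] gP [anabla _ gnabla] sf.
(* A pointwise choice of oriented charts, with no continuity in [p]. *)
pose oc p : chart R n M := s2val (cid2 (Bcover p)).
have ocB p : B (oc p) := s2valP (cid2 (Bcover p)).
have ocd p : dom (oc p) p := s2valP' (cid2 (Bcover p)).
split; first exact: affine_connection_nabla_df.
exists (volume g oc f); first exact: (volume_form_volume gP Bsmooth Bor ocB ocd sf).
move=> X Y sX sY p.
exact: (parallel_at gP Bsmooth Bor ocB ocd sf gnabla sX erefl sY).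
Qed.
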